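(* Let $p=p(m)$ with $m/p\to c\in(0,\infty)$ as $m,p\to\infty$. For each $m$ let $\mathbf{A}_m$ be a deterministic real $m\times p$ matrix with nonnegative entries such that $\frac{1}{mp}\operatorname{tr}(\mathbf{A}_m\mathbf{A}_m^\top)$ is uniformly bounded in $m$, and let $\mathbf{\Sigma}_m$ be a deterministic $m\times m$ positive definite covariance matrix with $\frac1m\operatorname{tr}(\mathbf{\Sigma}_m)$ bounded uniformly in $m$; let $\mathbf{\Sigma}_m^{1/2}$ be its symmetric positive definite square root. Fix an integer $n>1$ and for $k=1,\dots,n$ let $\tilde{\mathbf{A}}_m^k=\mathbf{A}_m+\mathbf{\Sigma}_m^{1/2}\mathbf{E}_m^k$, where $\mathbf{E}_m^1,\dots,\mathbf{E}_m^n$ are independent random $m\times p$ matrices with i.i.d. entries of mean zero, variance one and finite $(4+\varepsilon)$-th moment for some $\varepsilon>0$. Let $\bar{\mathbf{A}}_m=\frac1n\sum_{k=1}^n\tilde{\mathbf{A}}_m^k$ and let $\mathbf{U}_m$ be the $m\times p$ matrix of all ones. Then, as $m,p\to\infty$ with $m/p\to c$, $$\Big|\tfrac1{mp}\operatorname{tr}(\bar{\mathbf{A}}_{m} \mathbf{U}_{m}^\top)-\tfrac1{mp}\operatorname{tr}(\mathbf{A}_{m} \mathbf{U}_{m}^\top)\Big|\xrightarrow{a.s.}0,\qquad \Big|\tfrac1{mp}\operatorname{tr}(\bar{\mathbf{A}}_{m} \mathbf{A}_{m}^\top)-\tfrac1{mp}\operatorname{tr}(\mathbf{A}_{m} \mathbf{A}_{m}^\top)\Big|\xrightarrow{a.s.}0,$$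 $$\Big|\tfrac1{mp}\operatorname{tr}(\bar{\mathbf{A}}_{m} \bar{\mathbf{A}}^\top_{m})-\tfrac1{mp}\operatorname{tr}(\mathbf{A}_{m} \mathbf{A}_{m}^\top)-\tfrac{1}{nm}\operatorname{tr}(\mathbf{\Sigma}_m)\Big|\xrightarrow{a.s.}0.$$ *)

(* Defs.v *)
From HB Require Import structures.
From mathcomp Require Import all_boot all_order all_algebra.
From mathcomp Require Import all_classical all_reals all_analysis.
Set Implicit Arguments. Unset Strict Implicit. Unset Printing Implicit Defensive.
Import Order.TTheory GRing.Theory Num.Theory numFieldNormedType.Exports.
Local Open Scope ring_scope.
Local Open Scope classical_set_scope.

Definition posdef (R : realType) (m : nat) (M : 'M[R]_m) : Prop :=
  M^T = M /\ forall v : 'cV[R]_m, v != 0 -> 0 < (v^T *m M *m v) 0 0.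

Definition mutually_independent (d : measure_display) (T : measurableType d)
  (R : realType) (P : probability T R) (I : eqType) (S : set I)
  (X : I -> T -> R) : Prop :=
  forall (s : seq I), uniq s -> {subset s <= S} ->
  forall B : I -> set R, (forall i, measurable (B i)) ->
  P (\bigcap_(i in [set` s]) (X i @^-1` B i)) =
  (\prod_(i <- s) P (X i @^-1` B i))%E.

Definition identically_distributed (d : measure_display) (T : measurableType d)
  (R : realType) (P : probability T R) (X Y : T -> R) : Prop :=
  forall B : set R, measurable B -> P (X @^-1` B) = P (Y @^-1` B).

Definition Emat (T : Type) (R : realType) (p : nat -> nat)
  (X : nat -> nat -> nat -> nat -> T -> R) (m k : nat) (w : T)
  : 'M[R]_(m, p m) := \matrix_(i < m, j < p m) X m k i j w.

(* bar A_m = 1/n sum_{k=1}^n (A_m + Sigma_m^{1/2} E_m^k) *)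
Definition Abar (T : Type) (R : realType) (p : nat -> nat) (n : nat)
  (A : forall m, 'M[R]_(m, p m)) (S : forall m, 'M[R]_m)
  (X : nat -> nat -> nat -> nat -> T -> R) (m : nat) (w : T)
  : 'M[R]_(m, p m) :=
  n%:R^-1 *: \sum_(k < n) (A m + S m *m Emat p X m k w).

Definition ntr (R : realType) (m q : nat) (M N : 'M[R]_(m, q)) : R :=
  (m%:R * q%:R)^-1 * \tr (M *m N^T).

(* Main.v *)
(* Write Abar = A + S F with F the mean of the E^k.  For M = U or M = A the
   difference ntr Abar M - ntr A M is a linear form in the entries of the E^k,
   whose fourth moment is O(p^-2).  The quadratic form ntr (S F) (S F) splits
   into an off-diagonal chaos, whose fourth moment is again O(p^-2) by
   hypercontractivity, and a weighted sum of the centred squares x^2 - 1.  These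
   have moments of order 2 + delta only, so they are truncated at level p: the
   small part has fourth moment O(p^-(1+delta)) and the large part has first
   moment O(p^-(1+delta)).  All these bounds are summable in m, which gives
   almost sure convergence without any independence between different m. *)
Require Import Defs.
From HB Require Import structures.
From mathcomp Require Import all_boot all_order all_algebra.
From mathcomp Require Import all_classical all_reals all_analysis.
From mathcomp Require Import measurable_realfun ring lra.
Import Order.TTheory GRing.Theory Num.Theory numFieldNormedType.Exports.
Local Open Scope ring_scope.
Local Open Scope classical_set_scope.
Set Implicit Arguments. Unset Strict Implicit.

(** * Moments *)

(** Second moments are too weak: the available variance bound for the linear and off-diagonal forms
    is of order [p^-1], which is not summable. A fourth-moment bound for the diagonal squares would
    need eighth moments of the entries, hence the truncation. Only [tr Sigma] is controlled, so the
    largest eigenvalue of [Sigma] may grow like [m]. Every estimate therefore goes through the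
    Frobenius norm, with [|S|^2 = tr Sigma <= m beta]; a single diagonal weight may stay of constant
    order, and only the sum of the weights is spread over the [p] columns. Fourth powers are never
    expanded over multi-indices. Variables are added one at a time: the new one is independent of
    everything built from the earlier ones, and [(g + x h)^4] has five terms. This is why
    independence is developed for one variable against a function of a finite list of others. *)

Section Expectation.
Context (R : realType) (d : measure_display) (T : measurableType d)
  (P : probability T R).
Implicit Types f g h k : T -> R.

Definition integ f := P.-integrable setT (EFin \o f).
(** Real-valued through [fine], so an infinite integral reads as 0. Additivity and comparison
    therefore carry [integ] hypotheses, and an upper bound on a mean is informative only together
    with integrability. *)
Definition mean f : R := \int[P]_w f w.

Lemma integ_measurable f : integ f -> measurable_fun setT f.
Proof. by move=> /integrableP[/measurable_EFinP]. Qed.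

Lemma integ_dom f g : measurable_fun setT f -> integ g ->
  (forall w, `|f w| <= g w) -> integ f.
Proof.
move=> mf ig fg; apply: le_integrable ig => //; first exact/measurable_EFinP.
by move=> w _; rewrite /= lee_fin (le_trans (fg w))// ler_norm.
Qed.

Lemma integD f g : integ f -> integ g -> integ (fun w => f w + g w).
Proof. by move=> fi gi; exact: (integrableD measurableT fi gi). Qed.

Lemma integZ (a : R) f : integ f -> integ (fun w => a * f w).
Proof. by move=> fi; exact: (integrableZl measurableT a fi). Qed.

Lemma integB f g : integ f -> integ g -> integ (fun w => f w - g w).
Proof. by move=> fi gi; exact: (integrableB measurableT fi gi). Qed.

Lemma integ_cst (a : R) : integ (fun=> a).
Proof. exact: finite_measure_integrable_cst. Qed.

Lemma integ_norm f : integ f -> integ (fun w => `|f w|).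
Proof. exact: integrable_norm. Qed.

Lemma integ_sum (I : Type) (s : seq I) (f : I -> T -> R) :
  (forall i, integ (f i)) -> integ (fun w => \sum_(i <- s) f i w).
Proof.
move=> fi; elim: s => [|i s ih].
  by under eq_fun do rewrite big_nil; exact: integ_cst.
by under eq_fun do rewrite big_cons; exact: integD.
Qed.

Lemma meanD f g : integ f -> integ g ->
  mean (fun w => f w + g w) = mean f + mean g.
Proof. by move=> fi gi; rewrite /mean RintegralD. Qed.

Lemma meanB f g : integ f -> integ g ->
  mean (fun w => f w - g w) = mean f - mean g.
Proof. by move=> fi gi; rewrite /mean RintegralB. Qed.

Lemma meanZ a f : integ f -> mean (fun w => a * f w) = a * mean f.
Proof. by move=> fi; rewrite /mean RintegralZl. Qed.

Lemma mean_cst a : mean (fun=> a) = a.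
Proof.
have P1 : P setT = 1%E := probability_setT P.
by rewrite /mean Rintegral_cst// -[RHS]mulr1; congr (_ * _); exact: (congr1 fine P1).
Qed.

Lemma mean_sum (I : Type) (s : seq I) (f : I -> T -> R) :
  (forall i, integ (f i)) ->
  mean (fun w => \sum_(i <- s) f i w) = \sum_(i <- s) mean (f i).
Proof.
move=> fi; elim: s => [|i s ih].
  by under eq_fun do rewrite big_nil; rewrite mean_cst big_nil.
under eq_fun do rewrite big_cons.
by rewrite meanD ?ih ?big_cons//; exact: integ_sum.
Qed.

Lemma le_mean f g : integ f -> integ g -> (forall w, f w <= g w) ->
  mean f <= mean g.
Proof. by move=> fi gi fg; apply: le_Rintegral. Qed.

Lemma mean_ge0 f : (forall w, 0 <= f w) -> 0 <= mean f.
Proof. by move=> f0; apply: Rintegral_ge0. Qed.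

Lemma EFin_mean f : integ f -> (mean f)%:E = (\int[P]_w (f w)%:E)%E.
Proof. by move=> fi; rewrite fineK//; exact: integrable_fin_num. Qed.

Lemma le_norm_mean f : integ f -> `|mean f| <= mean (fun w => `|f w|).
Proof. by move=> fi; exact: le_normr_Rintegral. Qed.

End Expectation.

Ltac integ_auto := repeat first
  [assumption | exact: integ_cst | apply: integD | apply: integB | apply: integZ].

(** * Functions with a finite fourth moment *)

Section FourthMoments.
Context (R : realType) (d : measure_display) (T : measurableType d)
  (P : probability T R).
Implicit Types f g h k : T -> R.
Local Notation integ := (integ P).
Local Notation mean := (mean P).

(** The class in which [(g + x h)^4] can be integrated term by term: by AM-GM a product of four
    members is integrable, and shorter products follow by padding with the constant 1. *)
Definition L4 f := measurable_fun setT f /\ integ (fun w => f w ^+ 4).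

Lemma le_norm_prod4 (a b c e : R) :
  `|a * b * c * e| <= a ^+ 4 + b ^+ 4 + c ^+ 4 + e ^+ 4.
Proof.
have sq (x y : R) : 2 * (x * y) <= x ^+ 2 + y ^+ 2.
  by have := sqr_ge0 (x - y); lra.
have e4 (x : R) : x ^+ 4 = `|x| ^+ 4.
  by rewrite -normrX ger0_norm ?exprn_even_ge0.
rewrite !normrM (e4 a) (e4 b) (e4 c) (e4 e).
move: `|a| `|b| `|c| `|e| => {}a {}b {}c {}e.
have := sq (a * b) (c * e); have := sq (a ^+ 2) (b ^+ 2).
have := sq (c ^+ 2) (e ^+ 2); have := sqr_ge0 (a ^+ 2).
have := sqr_ge0 (b ^+ 2); have := sqr_ge0 (c ^+ 2); have := sqr_ge0 (e ^+ 2).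
lra.
Qed.

Lemma L4_mul f g h k : L4 f -> L4 g -> L4 h -> L4 k ->
  integ (fun w => f w * g w * h w * k w).
Proof.
move=> [mf fi] [mg gi] [mh hi] [mk ki].
apply: (integ_dom (g := fun w => f w ^+ 4 + g w ^+ 4 + h w ^+ 4 + k w ^+ 4)).
- by do !apply: measurable_funM.
- by do !apply: integD.
- by move=> w; exact: le_norm_prod4.
Qed.

Lemma L4_cst a : L4 (fun=> a).
Proof. by split=> //; exact: integ_cst. Qed.

Lemma L4_mul3 f g h : L4 f -> L4 g -> L4 h -> integ (fun w => f w * g w * h w).
Proof.
move=> Lf Lg Lh; have := L4_mul Lf Lg Lh (L4_cst 1).
by under eq_fun do rewrite mulr1.
Qed.

Lemma L4_mul2 f g : L4 f -> L4 g -> integ (fun w => f w * g w).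
Proof.
move=> Lf Lg; have := L4_mul3 Lf Lg (L4_cst 1).
by under eq_fun do rewrite mulr1.
Qed.

Lemma L4_integ f : L4 f -> integ f.
Proof.
move=> Lf; have := L4_mul2 Lf (L4_cst 1).
by under eq_fun do rewrite mulr1.
Qed.

Lemma L4_sqr f : L4 f -> integ (fun w => f w ^+ 2).
Proof. by move=> Lf; under eq_fun do rewrite expr2; exact: L4_mul2. Qed.

Lemma L4_cube f : L4 f -> integ (fun w => f w ^+ 3).
Proof.
by move=> Lf; under eq_fun do rewrite exprS expr2 mulrA; exact: L4_mul3.
Qed.

Lemma L4Z a f : L4 f -> L4 (fun w => a * f w).
Proof.
move=> [mf fi]; split; first exact: measurable_funM.
by under eq_fun do rewrite exprMn; exact: integZ.
Qed.

Lemma L4D f g : L4 f -> L4 g -> L4 (fun w => f w + g w).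
Proof.
move=> Lf Lg; have [mf fi] := Lf; have [mg gi] := Lg.
split; first exact: measurable_funD.
apply: (integ_dom (g := fun w => 8 * (f w ^+ 4 + g w ^+ 4))).
- by apply: measurable_funX; exact: measurable_funD.
- by apply: integZ; exact: integD.
move=> w; rewrite ger0_norm ?exprn_even_ge0//.
move: (f w) (g w) => x y.
(* Nonnegative terms from which [lra] assembles [8 (x^4 + y^4) - (x + y)^4 >= 0]. *)
have := sqr_ge0 (x ^+ 2 - y ^+ 2).
have := mulr_ge0 (sqr_ge0 (x - y)) (sqr_ge0 (x + y)).
have := sqr_ge0 ((x - y) ^+ 2).
have := mulr_ge0 (sqr_ge0 (x - y)) (addr_ge0 (sqr_ge0 x) (sqr_ge0 y)).
lra.
Qed.

Lemma L4_sum (I : Type) (s : seq I) (f : I -> T -> R) :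
  (forall i, L4 (f i)) -> L4 (fun w => \sum_(i <- s) f i w).
Proof.
move=> fi; elim: s => [|i s ih].
  by under eq_fun do rewrite big_nil; exact: L4_cst.
by under eq_fun do rewrite big_cons; exact: L4D.
Qed.

Lemma mean_sqr_le f : L4 f -> mean f ^+ 2 <= mean (fun w => f w ^+ 2).
Proof.
move=> Lf; have fi := L4_integ Lf; have f2 := L4_sqr Lf.
have : 0 <= mean (fun w => (f w - mean f) ^+ 2).
  by apply: mean_ge0 => w; exact: sqr_ge0.
have -> : (fun w => (f w - mean f) ^+ 2) =
    (fun w => (f w ^+ 2 + (- 2 * mean f) * f w) + mean f ^+ 2).
  by apply/funext => w; ring.
rewrite meanD ?meanD ?meanZ ?mean_cst//; try by integ_auto.
by lra.
Qed.

(** The quadratic [s |-> E (s f^2 - g^2)^2] is nonnegative, so its discriminant is not positive. *)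
Lemma mean_CS f g : L4 f -> L4 g ->
  mean (fun w => f w ^+ 2 * g w ^+ 2) ^+ 2 <=
  mean (fun w => f w ^+ 4) * mean (fun w => g w ^+ 4).
Proof.
move=> Lf Lg; have [mf fi] := Lf; have [mg gi] := Lg.
have fgi : integ (fun w => f w ^+ 2 * g w ^+ 2).
  have := L4_mul Lf Lf Lg Lg.
  by congr integ; apply/funext => w; ring.
set a := mean (fun w => f w ^+ 4); set c := mean (fun w => g w ^+ 4).
set b := mean _.
have q (s : R) : 0 <= a * s ^+ 2 - 2 * b * s + c.
  have : 0 <= mean (fun w => (s * f w ^+ 2 - g w ^+ 2) ^+ 2).
    by apply: mean_ge0 => w; exact: sqr_ge0.
  have -> : (fun w => (s * f w ^+ 2 - g w ^+ 2) ^+ 2) =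
      (fun w => (s ^+ 2 * f w ^+ 4 + (- 2 * s) * (f w ^+ 2 * g w ^+ 2))
                + g w ^+ 4).
    by apply/funext => w; ring.
  rewrite meanD ?meanD ?meanZ//; try by integ_auto.
  by rewrite -/a -/b -/c; lra.
have a0 : 0 <= a by apply: mean_ge0 => w; rewrite exprn_even_ge0.
have [a_eq0|a_neq0] := eqVneq a 0.
  rewrite a_eq0 mul0r.
  have [->|b_neq0] := eqVneq b 0; first by rewrite expr0n.
  (* With [a = 0] the polynomial is affine of slope [- 2 b], and this [s] would give it the value
     -1. *)
  have := q ((c + 1) / (2 * b)); rewrite a_eq0 mul0r sub0r.
  rewrite mulrC divfK ?mulf_neq0//; lra.
(* [b / a] is the minimiser of the quadratic. *)
have := q (b / a); have ap : 0 < a by rewrite lt_neqAle eq_sym a_neq0.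
have -> : a * (b / a) ^+ 2 - 2 * b * (b / a) + c = (a * c - b ^+ 2) / a.
  by field.
by rewrite pmulr_lge0 ?invr_gt0// subr_ge0.
Qed.

End FourthMoments.

(** * Independence *)

Section Independence.
Context (R : realType) (d : measure_display) (T : measurableType d)
  (P : probability T R).

Definition indep2 (f g : T -> R) := forall B C : set R,
  measurable B -> measurable C ->
  (P ((f @^-1` B) `&` (g @^-1` C)) = P (f @^-1` B) * P (g @^-1` C))%E.

Lemma measurable_preim d' (T' : measurableType d') (f : T' -> R) (B : set R) :
  measurable_fun setT f -> measurable B -> measurable (f @^-1` B).
Proof. by move=> mf mB; rewrite -[_ @^-1` _]setTI; exact: mf. Qed.

Lemma indep2_comp (f g : T -> R) (phi psi : R -> R) :
  measurable_fun setT phi -> measurable_fun setT psi ->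
  indep2 f g -> indep2 (phi \o f) (psi \o g).
Proof.
move=> mphi mpsi fg B C mB mC.
exact: (fg _ _ (measurable_preim mphi mB) (measurable_preim mpsi mC)).
Qed.

Section joint_law.
Variables f g : T -> R.
Hypotheses (mf : measurable_fun setT f) (mg : measurable_fun setT g).
Hypotheses (fi : integ P f) (gi : integ P g) (fg : indep2 f g).

Let mfg : measurable_fun setT (fun w => (f w, g w)).
Proof. exact: measurable_fun_pair. Qed.

Let HF := isMeasurableFun.Build _ _ _ _ _ mf.
Let F : {mfun T >-> R} := HB.pack f HF.
Let HG := isMeasurableFun.Build _ _ _ _ _ mg.
Let G : {mfun T >-> R} := HB.pack g HG.
Let HFG := isMeasurableFun.Build _ _ _ _ _ mfg.
Let FG : {mfun T >-> (R * R)%type} := HB.pack (fun w => (f w, g w)) HFG.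

(** Independence is the product formula on rectangles, and rectangles determine the product
    measure. *)
Let law_eq (A : set (R * R)) : measurable A ->
  (distribution P F \x distribution P G)%E A = distribution P FG A.
Proof.
apply: product_measure_unique => B C mB mC.
exact: fg.
Qed.

(** Tonelli for the product law gives [E |f g| = E |f| E |g|], so first moments suffice. *)
Lemma indep2_integ : integ P (fun w => f w * g w).
Proof.
apply/integrableP; split.
  by apply/measurable_EFinP; exact: measurable_funM.
pose h (z : R * R) : \bar R := `|(z.1 * z.2)%:E|%E.
have mh : measurable_fun setT h.
  apply: measurableT_comp => //; apply/measurable_EFinP.
  by apply: measurable_funM; [exact: measurable_fst|exact: measurable_snd].
have -> : (\int[P]_x `|(EFin \o (fun w => (f w * g w)%R)) x| =
    \int[distribution P FG]_z h z)%E.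
  by rewrite ge0_integral_distribution// => z; exact: abse_ge0.
have -> : (\int[distribution P FG]_z h z =
    \int[distribution P F \x distribution P G]_z h z)%E.
  by apply: eq_measure_integral => A mA _; exact/esym/law_eq.
rewrite fubini_tonelli1//; last by move=> z; exact: abse_ge0.
rewrite /fubini_F.
have intF := integ_norm fi; have intG := integ_norm gi.
have G1 : (\int[distribution P G]_y `|y|%:E = (mean P (fun w => `|g w|))%:E)%E.
  rewrite (ge0_integral_distribution G (f := fun y : R => `|y|%:E))//=.
    by rewrite EFin_mean.
  by apply/measurable_EFinP; exact: normr_measurable.
have -> : (fun x => \int[distribution P G]_y h (x, y))%E =
   (fun x => `|x|%:E * (mean P (fun w => `|g w|))%:E)%E.
  apply/funext => x; rewrite -G1 -ge0_integralZl//.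
  - by apply: eq_integral => y _; rewrite /h /= normrM EFinM.
  - by apply/measurable_EFinP; exact: normr_measurable.
rewrite ge0_integralZr//; last 2 first.
- by apply/measurable_EFinP; exact: normr_measurable.
- by rewrite lee_fin; apply: mean_ge0 => w.
rewrite (ge0_integral_distribution F (f := fun y : R => `|y|%:E))//=; last first.
  by apply/measurable_EFinP; exact: normr_measurable.
by rewrite -EFin_mean// -EFinM ltry.
Qed.

Lemma mean_indep2 : mean P (fun w => f w * g w) = mean P f * mean P g.
Proof.
pose h (z : R * R) : \bar R := (z.1 * z.2)%:E.
have mh : measurable_fun setT h.
  apply/measurable_EFinP.
  by apply: measurable_funM; [exact: measurable_fst|exact: measurable_snd].
have hi : (distribution P F \x distribution P G)%E.-integrable setT h.
  have : (distribution P FG).-integrable setT h.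
    by apply: integrable_pushforward => //; exact: indep2_integ.
  move=> /integrableP[_ hoo]; apply/integrableP; split => //.
  apply: le_lt_trans hoo; rewrite le_eqVlt; apply/orP; left; apply/eqP.
  by apply: eq_measure_integral => A mA _; exact: law_eq.
apply: EFin_inj; rewrite EFin_mean; last exact: indep2_integ.
rewrite -(integral_distribution (X := FG) (f := h))//; last exact: indep2_integ.
have -> : (\int[distribution P FG]_z h z =
    \int[distribution P F \x distribution P G]_z h z)%E.
  by apply: eq_measure_integral => A mA _; exact/esym/law_eq.
rewrite -integral12_prod_meas1//.
have G1 : (\int[distribution P G]_y y%:E = (mean P g)%:E)%E.
  by rewrite (integral_distribution (X := G) (f := EFin))//= EFin_mean.
have Gi : (distribution P G).-integrable setT EFin.
  exact: integrable_pushforward.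
have -> : (fun x => \int[distribution P G]_y h (x, y))%E =
   (fun x => x%:E * (mean P g)%:E)%E.
  apply/funext => x; rewrite -G1 -integralZl//.
have Fi : (distribution P F).-integrable setT EFin.
  exact: integrable_pushforward.
rewrite integralZr// (integral_distribution (X := F) (f := EFin))//=.
by rewrite -EFin_mean.
Qed.
End joint_law.
End Independence.

(** * Independence of one variable from a function of finitely many others *)

Section Prefix.
Context (R : realType) (d : measure_display) (T : measurableType d)
  (P : probability T R) (I : eqType) (X : I -> T -> R).
Hypothesis mX : forall i, measurable_fun setT (X i).
Hypothesis iX : mutually_independent P setT X.

(** A pi-system generating the sigma-algebra of the [X i] with [i] in [s]. The sets [B i] are
    indexed by all of [I], so a family can be altered at an index outside [s] without changing the
    cylinder. *)
Definition cylinder (s : seq I) : set (set T) :=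
  [set A | exists2 B : I -> set R, (forall i, measurable (B i)) &
     A = \bigcap_(i in [set` s]) (X i @^-1` B i)].

(** Measurability on [T] re-equipped with the generated sigma-algebra: closure under sums and
    products is then inherited from measurable functions. *)
Definition adapted (s : seq I) (g : T -> R) :=
  measurable_fun setT (g : g_sigma_algebraType (cylinder s) -> R).

Lemma measurable_cylinder s : cylinder s `<=` measurable.
Proof.
move=> _ [B mB ->]; apply: fin_bigcap_measurable => // i _.
exact: measurable_preim.
Qed.

Lemma setI_closed_cylinder s : setI_closed (cylinder s).
Proof.
move=> _ _ [B mB ->] [C mC ->]; exists (fun i => B i `&` C i).
  by move=> i; exact: measurableI.
by rewrite -bigcapI.
Qed.

Lemma cylinderT s : cylinder s setT.
Proof. by exists (fun=> setT) => //; apply/esym/seteqP; split. Qed.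

Lemma adapted_measurable s g : adapted s g -> measurable_fun setT g.
Proof.
move=> ag _ B mB.
have : <<s cylinder s >> (setT `&` g @^-1` B) by exact: ag.
apply: smallest_sub; first exact: sigma_algebra_measurable.
exact: measurable_cylinder.
Qed.

Lemma adaptedX s i : i \in s -> adapted s (X i).
Proof.
move=> si _ B mB; rewrite setTI; apply: sub_sigma_algebra.
exists (fun j => if j == i then B else setT) => [j|]; first by case: ifP.
apply/seteqP; split=> [w Bw j _|w /(_ i)] /=; last by rewrite eqxx; exact.
by case: eqP => [->|].
Qed.

Lemma adapted_cst s a : adapted s (fun=> a).
Proof. exact: measurable_cst. Qed.

Lemma adaptedD s g h : adapted s g -> adapted s h ->
  adapted s (fun w => g w + h w).
Proof. by move=> ag ah; exact: measurable_funD. Qed.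

Lemma adaptedM s g h : adapted s g -> adapted s h ->
  adapted s (fun w => g w * h w).
Proof. by move=> ag ah; exact: measurable_funM. Qed.

Lemma adapted_sum s (J : eqType) (r : seq J) (g : J -> T -> R) :
  (forall j, j \in r -> adapted s (g j)) ->
  adapted s (fun w => \sum_(j <- r) g j w).
Proof.
elim: r => [_|j r ih ag].
  by under eq_fun do rewrite big_nil; exact: adapted_cst.
under eq_fun do rewrite big_cons.
apply: adaptedD; first by apply: ag; rewrite mem_head.
by apply: ih => k kr; apply: ag; rewrite inE kr orbT.
Qed.

(** Dynkin's argument: with [B] fixed, the finite measures [A |-> P (A and X t in B)] and
    [A |-> P (X t in B) P A] agree on cylinders over [s], hence on the sigma-algebra these
    generate. *)
Lemma indep2_adapted t s g : uniq (t :: s) -> adapted s g ->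
  indep2 P (X t) g.
Proof.
move=> uts ag B C mB mC.
have mD : measurable (X t @^-1` B) by exact: measurable_preim.
have r0 : 0 <= fine (P (X t @^-1` B)) by exact: fine_ge0.
pose m1 : {measure set T -> \bar R} := mrestr P mD.
pose m2 : {measure set T -> \bar R} := mscale (NngNum r0) P.
have PD : (fine (P (X t @^-1` B)))%:E = P (X t @^-1` B).
  by rewrite fineK// fin_num_measure.
have m2E A : m2 A = (P (X t @^-1` B) * P A)%E by rewrite -PD.
have sA : <<s cylinder s >> (g @^-1` C).
  by rewrite -[_ @^-1` _]setTI; exact: ag.
rewrite setIC -m2E -[LHS]/(m1 (g @^-1` C)).
apply: (g_sigma_algebra_measure_unique (cylinder s) _ (fun=> setT)) => //.
- exact: measurable_cylinder.
- by move=> _; exact: cylinderT.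
- by apply/seteqP; split => // w _; exists 0%N.
- exact: setI_closed_cylinder.
- move=> A [B' mB' ->]; rewrite m2E /m1 /= /mrestr.
  (* As [t] is not in [s], resetting [B'] at [t] to [B] leaves the cylinder over [s] unchanged and
     merges both events into one cylinder over [t :: s]. *)
  pose B2 i := if i == t then B else B' i.
  have mB2 i : measurable (B2 i) by rewrite /B2; case: ifP.
  have B2s : \bigcap_(i in [set` s]) (X i @^-1` B' i) =
             \bigcap_(i in [set` s]) (X i @^-1` B2 i).
    apply: eq_bigcapr => i /= si; rewrite /B2; case: eqP => // it.
    by move: uts; rewrite /= -it si.
  have -> : \bigcap_(i in [set` s]) (X i @^-1` B' i) `&` X t @^-1` B =
      \bigcap_(i in [set` t :: s]) (X i @^-1` B2 i).
    rewrite B2s; apply/seteqP; split.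
      move=> w [h1 h2] i /=; rewrite inE => /predU1P[->|]; last exact: h1.
      by rewrite /B2 eqxx.
    move=> w h; split; first by move=> i si; apply: h; rewrite /= inE si orbT.
    by have := h t; rewrite /B2 /= eqxx inE eqxx; exact.
  have sT (r : seq I) : {subset r <= [set: I]} by move=> i _; rewrite in_setT.
  rewrite iX// big_cons {1}/B2 eqxx B2s -(iX _ (sT s))//.
  by case/andP: uts.
- by move=> _; rewrite /m1 /= /mrestr setTI -PD ltry.
Qed.

End Prefix.

(** * Fourth moments of linear and quadratic forms *)

Section IndependentSums.
Context (R : realType) (d : measure_display) (T : measurableType d)
  (P : probability T R) (I : eqType) (x : I -> T -> R).
Hypothesis Lx : forall i, L4 P (x i).
Hypothesis ix : mutually_independent P setT x.
Hypothesis x0 : forall i, mean P (x i) = 0.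

Let mx i : measurable_fun setT (x i). Proof. by case: (Lx i). Qed.

Section step.
Variables (t : I) (s : seq I).
Hypothesis uts : uniq (t :: s).

Lemma indep2_powX k g l : adapted x s g ->
  indep2 P (fun w => x t w ^+ k) (fun w => g w ^+ l).
Proof.
move=> ag; apply: (indep2_comp (phi := fun z => z ^+ k)
  (psi := fun z => z ^+ l) _ _ (indep2_adapted mx ix uts ag));
  exact: measurable_funX.
Qed.

Lemma mean_powM k g : adapted x s g -> integ P (fun w => x t w ^+ k) ->
  integ P g ->
  integ P (fun w => x t w ^+ k * g w) /\
  mean P (fun w => x t w ^+ k * g w) = mean P (fun w => x t w ^+ k) * mean P g.
Proof.
move=> ag xi gi.
(* [l = 1], since [g w ^+ 1] is convertible to [g w]. *)
have xg : indep2 P (fun w => x t w ^+ k) g by exact: (@indep2_powX k g 1 ag).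
have mg := adapted_measurable mx ag.
have mxk : measurable_fun setT (fun w => x t w ^+ k) by exact: measurable_funX.
by split; [exact: indep2_integ | exact: mean_indep2].
Qed.

(** A product of two members of [L4] can fail to be in [L4]; here independence factors its fourth
    moment. *)
Lemma L4_mulX g : adapted x s g -> L4 P g -> L4 P (fun w => x t w * g w).
Proof.
move=> ag [mg gi]; split; first exact: measurable_funM.
under eq_fun do rewrite exprMn.
have [_ xi] := Lx t; apply: indep2_integ => //.
- exact: measurable_funX.
- exact: measurable_funX.
- exact: indep2_powX.
Qed.

(* Integrate out [x_t]: having mean zero, it kills the [g^3 h] term. *)
Lemma mean_pow4_step g h : adapted x s g -> adapted x s h -> L4 P g -> L4 P h ->
  mean P (fun w => (g w + x t w * h w) ^+ 4) =
  mean P (fun w => g w ^+ 4) +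
  6 * mean P (fun w => x t w ^+ 2) * mean P (fun w => g w ^+ 2 * h w ^+ 2) +
  4 * mean P (fun w => x t w ^+ 3) * mean P (fun w => g w * h w ^+ 3) +
  mean P (fun w => x t w ^+ 4) * mean P (fun w => h w ^+ 4).
Proof.
move=> ag ah Lg Lh.
have x1 : integ P (fun w => x t w ^+ 1) by exact: (L4_integ (Lx t)).
have x2 := L4_sqr (Lx t); have x3 := L4_cube (Lx t); have [_ x4] := Lx t.
have [_ g4] := Lg; have [_ h4] := Lh.
have i31 : integ P (fun w => g w * g w * g w * h w) by exact: L4_mul.
have i22 : integ P (fun w => g w ^+ 2 * h w ^+ 2).
  have := L4_mul Lg Lg Lh Lh.
  by congr integ; apply/funext => w; ring.
have i13 : integ P (fun w => g w * h w ^+ 3).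
  have := L4_mul Lg Lh Lh Lh.
  by congr integ; apply/funext => w; ring.
have a2 g' : adapted x s g' -> adapted x s (fun w => g' w ^+ 2).
  by move=> ?; under eq_fun do rewrite expr2; exact: adaptedM.
have a3 g' : adapted x s g' -> adapted x s (fun w => g' w ^+ 3).
  by move=> ?; under eq_fun do rewrite exprS; apply: adaptedM => //; exact: a2.
have a4 g' : adapted x s g' -> adapted x s (fun w => g' w ^+ 4).
  by move=> ?; under eq_fun do rewrite exprS; apply: adaptedM => //; exact: a3.
have [j1 e1] := @mean_powM 1 (fun w => g w * g w * g w * h w)
  (adaptedM (adaptedM (adaptedM ag ag) ag) ah) x1 i31.
have [j2 e2] := mean_powM (adaptedM (a2 _ ag) (a2 _ ah)) x2 i22.
have [j3 e3] := mean_powM (adaptedM ag (a3 _ ah)) x3 i13.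
have [j4 e4] := mean_powM (a4 _ ah) x4 h4.
have -> : (fun w => (g w + x t w * h w) ^+ 4) =
    (fun w => g w ^+ 4 + 4 * (x t w ^+ 1 * (g w * g w * g w * h w))
     + 6 * (x t w ^+ 2 * (g w ^+ 2 * h w ^+ 2))
     + 4 * (x t w ^+ 3 * (g w * h w ^+ 3)) + x t w ^+ 4 * h w ^+ 4).
  by apply/funext => w; ring.
rewrite meanD ?meanD ?meanZ//; try by integ_auto.
rewrite e1 e2 e3 e4 (_ : mean P (fun w => x t w ^+ 1) = 0); first ring.
exact: x0.
Qed.

Lemma mean_pow2_step g : adapted x s g -> L4 P g ->
  mean P (fun w => (g w + x t w) ^+ 2) =
  mean P (fun w => g w ^+ 2) + mean P (fun w => x t w ^+ 2).
Proof.
move=> ag Lg.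
have x1 : integ P (fun w => x t w ^+ 1) by exact: (L4_integ (Lx t)).
have x2 := L4_sqr (Lx t); have g2 := L4_sqr Lg.
have [j1 e1] := mean_powM ag x1 (L4_integ Lg).
have -> : (fun w => (g w + x t w) ^+ 2) =
    (fun w => g w ^+ 2 + 2 * (x t w ^+ 1 * g w) + x t w ^+ 2).
  by apply/funext => w; ring.
rewrite meanD ?meanD ?meanZ//; try by integ_auto.
rewrite e1 (_ : mean P (fun w => x t w ^+ 1) = 0); first ring.
exact: x0.
Qed.

End step.

Lemma adapted_sumX s : adapted x s (fun w => \sum_(i <- s) x i w).
Proof. by apply: adapted_sum => i si; exact: adaptedX. Qed.

Lemma mean_sum_pow2 s : uniq s ->
  mean P (fun w => (\sum_(i <- s) x i w) ^+ 2) =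
  \sum_(i <- s) mean P (fun w => x i w ^+ 2).
Proof.
elim: s => [_|t s ih uts].
  under eq_fun do rewrite big_nil expr0n /=.
  by rewrite mean_cst big_nil.
under eq_fun do rewrite big_cons addrC.
rewrite (mean_pow2_step uts (@adapted_sumX s)) ?big_cons; last exact: L4_sum.
by rewrite ih 1?addrC//; case/andP: uts.
Qed.

(** Induction by the one-step expansion with [h = 1]: the remaining cubic term contains the mean of
    the partial sum, which is 0, and [6 E x_t^2] times the second moment of the partial sum is the
    double product in [3 (a + b)^2]. *)
Lemma mean_sum_pow4 s : uniq s ->
  mean P (fun w => (\sum_(i <- s) x i w) ^+ 4) <=
  \sum_(i <- s) mean P (fun w => x i w ^+ 4) +
  3 * (\sum_(i <- s) mean P (fun w => x i w ^+ 2)) ^+ 2.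
Proof.
elim: s => [_|t s ih uts].
  under eq_fun do rewrite big_nil expr0n /=.
  by rewrite mean_cst !big_nil expr0n/= mulr0 addr0.
have us : uniq s by case/andP: uts.
under eq_fun do rewrite big_cons addrC -[x t _]mulr1.
rewrite (mean_pow4_step uts (@adapted_sumX s) (@adapted_cst R d T I x s 1))//; last 2 first.
- exact: L4_sum.
- exact: L4_cst.
have -> : (fun w : T => (\sum_(i <- s) x i w) ^+ 2 * 1 ^+ 2) =
    (fun w : T => (\sum_(i <- s) x i w) ^+ 2).
  by apply/funext => w; rewrite expr1n mulr1.
have -> : (fun w : T => (\sum_(i <- s) x i w) * 1 ^+ 3) =
    (fun w : T => (\sum_(i <- s) x i w)).
  by apply/funext => w; rewrite expr1n mulr1.
have -> : (fun w : T => (1 : R) ^+ 4) = (fun=> 1).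
  by apply/funext => w; rewrite expr1n.
rewrite mean_cst mean_sum_pow2// mean_sum; last by move=> i; exact: L4_integ.
rewrite (_ : \sum_(i <- s) mean P (x i) = 0); last by rewrite big1.
rewrite !big_cons.
have := ih us.
have := sqr_ge0 (mean P (fun w => x t w ^+ 2)).
lra.
Qed.

End IndependentSums.

Lemma mutually_independent_comp (R : realType) (d : measure_display)
    (T : measurableType d) (P : probability T R) (I : eqType) (S : set I)
    (X : I -> T -> R) (phi : I -> R -> R) :
  (forall i, measurable_fun setT (phi i)) ->
  mutually_independent P S X ->
  mutually_independent P S (fun i => phi i \o X i).
Proof.
move=> mphi iX s us sS B mB.
apply: (iX s us sS (fun i => phi i @^-1` B i)) => i.
exact: measurable_preim.
Qed.

(** * Linear forms and off-diagonal quadratic forms in standardised variables *)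

Section Forms.
Context (R : realType) (d : measure_display) (T : measurableType d)
  (P : probability T R) (I : eqType) (x : I -> T -> R) (kappa : R).
Hypothesis Lx : forall i, L4 P (x i).
Hypothesis ix : mutually_independent P setT x.
Hypothesis x0 : forall i, mean P (x i) = 0.
Hypothesis x2 : forall i, mean P (fun w => x i w ^+ 2) = 1.
Hypothesis x4 : forall i, mean P (fun w => x i w ^+ 4) <= kappa.
Hypothesis kappa1 : 1 <= kappa.

Let mx i : measurable_fun setT (x i). Proof. by case: (Lx i). Qed.

Lemma sum_sqr_le_sqr_sum (J : Type) (s : seq J) (a : J -> R) :
  (forall j, 0 <= a j) -> \sum_(j <- s) a j ^+ 2 <= (\sum_(j <- s) a j) ^+ 2.
Proof.
move=> a0; elim: s => [|j s ih]; first by rewrite !big_nil expr0n.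
rewrite !big_cons sqrrD; apply: lerD => //.
by rewrite lerDl mulrn_wge0// mulr_ge0// sumr_ge0.
Qed.

(** [kappa] pays for the fourth powers, since [sum a_i^4 <= (sum a_i^2)^2], and 3 for the pairs. *)
Lemma mean_linear_pow4 (a : I -> R) s : uniq s ->
  mean P (fun w => (\sum_(i <- s) a i * x i w) ^+ 4) <=
  (kappa + 3) * (\sum_(i <- s) a i ^+ 2) ^+ 2.
Proof.
move=> us.
have Ly i : L4 P (fun w => a i * x i w) by exact: L4Z.
have iy : mutually_independent P setT (fun i w => a i * x i w).
  by apply: (mutually_independent_comp (phi := fun i z => a i * z)) => // i;
    exact: measurable_funM.
have y0 i : mean P (fun w => a i * x i w) = 0.
  by rewrite meanZ ?x0 ?mulr0//; exact: L4_integ.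
apply: (le_trans (mean_sum_pow4 Ly iy y0 us)).
rewrite [X in _ <= X](_ : _ = kappa * (\sum_(i <- s) a i ^+ 2) ^+ 2 +
  3 * (\sum_(i <- s) a i ^+ 2) ^+ 2); last by ring.
apply: lerD.
  apply: (@le_trans _ _ (\sum_(i <- s) kappa * (a i ^+ 2) ^+ 2)).
    apply: ler_sum => i _; under eq_fun do rewrite exprMn.
    rewrite meanZ; last by case: (Lx i).
    rewrite -exprM mulrC ler_wpM2r// ?exprn_even_ge0//.
  rewrite -mulr_sumr ler_wpM2l//; first by rewrite (le_trans ler01).
  by apply: sum_sqr_le_sqr_sum => j; exact: sqr_ge0.
rewrite (eq_bigr (fun i => a i ^+ 2))// => i _.
under eq_fun do rewrite exprMn.
by rewrite meanZ ?x2 ?mulr1//; exact: L4_sqr.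
Qed.

Variable M : I -> I -> R.

Definition offdiag_form (s : seq I) (w : T) : R :=
  \sum_(i <- s) \sum_(j <- s | j != i) M i j * x i w * x j w.

Let offdiag_cons (t : I) (s : seq I) (f : I -> I -> R) : t \notin s ->
  \sum_(i <- t :: s) \sum_(j <- t :: s | j != i) f i j =
  \sum_(i <- s) \sum_(j <- s | j != i) f i j + \sum_(j <- s) (f t j + f j t).
Proof.
move=> ts; rewrite big_cons big_cons eqxx /=.
rewrite (_ : \sum_(j <- s | j != t) f t j = \sum_(j <- s) f t j); last first.
  rewrite big_seq_cond [RHS]big_seq; apply: eq_bigl => j.
  by rewrite andb_idr// => js; apply: contraNneq ts => <-.
rewrite (_ : \sum_(i <- s) \sum_(j <- t :: s | j != i) f i j =
    \sum_(i <- s) (f i t + \sum_(j <- s | j != i) f i j)); last first.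
  rewrite !big_seq; apply: eq_bigr => i is_.
  by rewrite big_cons ifT//; apply: contraNneq ts => ->.
by rewrite !big_split /=; ring.
Qed.

(** Coefficient of [x t] when [t] joins [s]: [M] need not be symmetric, so both orders of each pair
    contribute. *)
Let L t s w := \sum_(j <- s) (M t j + M j t) * x j w.

Lemma offdiag_form_cons t s w : t \notin s ->
  offdiag_form (t :: s) w = offdiag_form s w + x t w * L t s w.
Proof.
move=> ts; rewrite /offdiag_form offdiag_cons//; congr (_ + _).
by rewrite mulr_sumr; apply: eq_bigr => j _; ring.
Qed.

Let adapted_L t s : adapted x s (L t s).
Proof.
apply: adapted_sum => j js; apply: adaptedM; last exact: adaptedX.
exact: adapted_cst.
Qed.

Let L4_L t s : L4 P (L t s).
Proof. by apply: L4_sum => j; exact: L4Z. Qed.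

Lemma adapted_offdiag_form s : adapted x s (offdiag_form s).
Proof.
apply: adapted_sum => i si; under eq_fun do rewrite -big_filter.
apply: adapted_sum => j; rewrite mem_filter => /andP[_ sj].
apply: adaptedM; last exact: adaptedX.
by apply: adaptedM; [exact: adapted_cst|exact: adaptedX].
Qed.

Lemma L4_offdiag_form s : uniq s -> L4 P (offdiag_form s).
Proof.
elim: s => [_|t s ih uts].
  rewrite (_ : offdiag_form [::] = fun=> 0); first exact: L4_cst.
  by apply/funext => w; rewrite /offdiag_form big_nil.
have [ts us] := andP uts.
rewrite (_ : offdiag_form _ = fun w => offdiag_form s w + x t w * L t s w).
  apply: L4D; first exact: ih.
  exact: (L4_mulX Lx ix uts (@adapted_L t s)).
by apply/funext => w; exact: offdiag_form_cons.
Qed.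

(** From [x^2 (1 - |x|)^2 >= 0], that is [2 |x|^3 <= x^2 + x^4]. *)
Let x3 i : `|mean P (fun w => x i w ^+ 3)| <= (1 + kappa) / 2.
Proof.
apply: (le_trans (le_norm_mean (L4_cube (Lx i)))).
apply: (@le_trans _ _
  (mean P (fun w => 2^-1 * (x i w ^+ 2 + x i w ^+ 4)))).
  apply: le_mean.
  - exact: (integ_norm (L4_cube (Lx i))).
  - by apply: integZ; apply: integD; [exact: L4_sqr|case: (Lx i)].
  - move=> w; rewrite normrX.
    rewrite (_ : x i w ^+ 2 = `|x i w| ^+ 2); last first.
      by rewrite -normrX ger0_norm ?sqr_ge0.
    rewrite (_ : x i w ^+ 4 = `|x i w| ^+ 4); last first.
      by rewrite -normrX ger0_norm ?exprn_even_ge0.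
    have := sqr_ge0 (`|x i w| * (1 - `|x i w|)).
    by lra.
have [_ x4i] := Lx i; have x2i := L4_sqr (Lx i).
rewrite meanZ ?meanD ?x2//; last exact: integD.
by have := x4 i; lra.
Qed.

(** Write [D = 4 (kappa + 3)], the constant for the linear form [L], and [K] for this constant. The
    induction step bounds the new moment by [q4 + (7 + kappa) q22 + (1 + 2 kappa) l4], where
    [7 + kappa] is the binomial 6 plus [1 + kappa] from the cubic term. Cauchy-Schwarz gives
    [q22 <= sqrt (K D) Vs inc], and [K = (7 + kappa)^2 D] makes [(7 + kappa) sqrt (K D) = K], which
    fits in the double product of [K (Vs + inc)^2]. *)
Definition offdiag_const : R := (7 + kappa) ^+ 2 * (4 * (kappa + 3)).

(* Hypercontractivity of quadratic chaos, by induction on the variables: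
   conditioning on the last one reduces the degree. *)
Lemma mean_offdiag_pow4 s : uniq s ->
  mean P (fun w => offdiag_form s w ^+ 4) <=
  offdiag_const * (\sum_(i <- s) \sum_(j <- s | j != i) M i j ^+ 2) ^+ 2.
Proof.
elim: s => [_|t s ih uts].
  rewrite (_ : (fun w => _) = fun=> 0) ?mean_cst; last first.
    by apply/funext => w; rewrite /offdiag_form big_nil expr0n.
  by rewrite big_nil expr0n/= mulr0.
have [ts us] := andP uts; move/(_ us) : ih => ih.
rewrite (_ : (fun w => _) =
  fun w => (offdiag_form s w + x t w * L t s w) ^+ 4); last first.
  by apply/funext => w; rewrite offdiag_form_cons.
have LQ := L4_offdiag_form us; have LL := L4_L t s.
rewrite (mean_pow4_step Lx ix x0 uts (@adapted_offdiag_form s)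
  (@adapted_L t s) LQ LL) x2 offdiag_cons//.
move: ih; set Vs := \sum_(i <- s) _; set inc := \sum_(j <- s) _ => ih.
have Vs0 : 0 <= Vs by do 2 (apply: sumr_ge0 => ? _); exact: sqr_ge0.
have inc0 : 0 <= inc.
  by apply: sumr_ge0 => j _; apply: addr_ge0; exact: sqr_ge0.
set q4 := mean P (fun w => offdiag_form s w ^+ 4) in ih *.
set q22 := mean P (fun w => _ ^+ 2 * _); set q13 := mean P (fun w => _ * _).
set l4 := mean P (fun w => L t s w ^+ 4).
(* The factor 4 is that of [(2 inc)^2], from [(u + v)^2 <= 2 (u^2 + v^2)] applied to
   [M t j + M j t]. *)
have l4_le : l4 <= 4 * (kappa + 3) * inc ^+ 2.
  apply: (le_trans (mean_linear_pow4 _ us)).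
  rewrite (_ : 4 * (kappa + 3) * inc ^+ 2 = (kappa + 3) * (2 * inc) ^+ 2);
    last by ring.
  apply: ler_wpM2l; first by move: kappa1; lra.
  apply: lerXn2r; rewrite ?nnegrE ?mulr_ge0//.
    by apply: sumr_ge0 => j _; exact: sqr_ge0.
  rewrite /inc mulr_sumr; apply: ler_sum => j _.
  by have := sqr_ge0 (M t j - M j t); lra.
have l40 : 0 <= l4 by apply: mean_ge0 => w; rewrite exprn_even_ge0.
have q220 : 0 <= q22.
  by apply: mean_ge0 => w; apply: mulr_ge0; exact: sqr_ge0.
have q40 : 0 <= q4 by apply: mean_ge0 => w; rewrite exprn_even_ge0.
have q22_le : q22 <= (7 + kappa) * (4 * (kappa + 3)) * (Vs * inc).
  rewrite -(@ler_pXn2r _ 2)// ?nnegrE//; last first.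
    by rewrite !mulr_ge0//; move: kappa1; lra.
  apply: (le_trans (mean_CS LQ LL)).
  rewrite (_ : _ ^+ 2 = (offdiag_const * Vs ^+ 2) *
    (4 * (kappa + 3) * inc ^+ 2)); last by rewrite /offdiag_const; ring.
  exact: ler_pM.
(* [2 |u v^3| <= u^2 v^2 + v^4] spreads the cubic cross term over two terms already controlled. *)
have q13_le : `|q13| <= (q22 + l4) / 2.
  have i13 : integ P (fun w => offdiag_form s w * L t s w ^+ 3).
    have := L4_mul LQ LL LL LL.
    by congr integ; apply/funext => w; ring.
  have i22 : integ P (fun w => offdiag_form s w ^+ 2 * L t s w ^+ 2).
    have := L4_mul LQ LQ LL LL.
    by congr integ; apply/funext => w; ring.
  have i04 : integ P (fun w => L t s w ^+ 4) by case: LL.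
  apply: (le_trans (le_norm_mean i13)).
  apply: (@le_trans _ _ (mean P (fun w =>
    2^-1 * (offdiag_form s w ^+ 2 * L t s w ^+ 2 + L t s w ^+ 4)))).
    apply: le_mean; [exact: integ_norm|by integ_auto|move=> w].
    rewrite ler_norml; move: (offdiag_form s w) (L t s w) => u v.
    have := sqr_ge0 (v * (u - v)); have := sqr_ge0 (v * (u + v)).
    by move=> h1 h2; apply/andP; split; lra.
  by rewrite meanZ ?meanD 1?[X in X <= _]mulrC//; integ_auto.
have h3 : 4 * mean P (fun w => x t w ^+ 3) * q13 <= (1 + kappa) * (q22 + l4).
  apply: (le_trans (ler_norm _)); rewrite !normrM [`|4|]ger0_norm//.
  have := ler_pM (normr_ge0 _) (normr_ge0 _) (x3 t) q13_le.
  by lra.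
have h4 : mean P (fun w => x t w ^+ 4) * l4 <= kappa * l4 by exact: ler_wpM2r.
apply: (@le_trans _ _ (offdiag_const * Vs ^+ 2 +
   (7 + kappa) * ((7 + kappa) * (4 * (kappa + 3)) * (Vs * inc)) +
   (1 + 2 * kappa) * (4 * (kappa + 3) * inc ^+ 2))).
  have h5 : (7 + kappa) * q22 <=
      (7 + kappa) * ((7 + kappa) * (4 * (kappa + 3)) * (Vs * inc)).
    by apply: ler_wpM2l => //; move: kappa1; lra.
  have h6 : (1 + 2 * kappa) * l4 <=
      (1 + 2 * kappa) * (4 * (kappa + 3) * inc ^+ 2).
    by apply: ler_wpM2l => //; move: kappa1; lra.
  by lra.
have Vi0 : 0 <= offdiag_const * (Vs * inc).
  by rewrite /offdiag_const !mulr_ge0//; move: kappa1; lra.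
have i20 : 0 <= 4 * (kappa + 3) * inc ^+ 2.
  by rewrite !mulr_ge0//; move: kappa1; lra.
have : (1 + 2 * kappa) * (4 * (kappa + 3) * inc ^+ 2) <=
    (7 + kappa) ^+ 2 * (4 * (kappa + 3) * inc ^+ 2).
  apply: ler_wpM2r => //; have := sqr_ge0 kappa; move: kappa1; lra.
by move: Vi0; rewrite /offdiag_const; lra.
Qed.

End Forms.

Lemma L4_bounded (R : realType) (d : measure_display) (T : measurableType d)
    (P : probability T R) (f : T -> R) (c : R) :
  measurable_fun setT f -> (forall w, `|f w| <= c) -> L4 P f.
Proof.
move=> mf fc; split => //; apply: (integ_dom _ (integ_cst P (c ^+ 4))).
  exact: measurable_funX.
by move=> w; rewrite normrX lerXn2r// nnegrE// (le_trans _ (fc w)).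
Qed.

(** * Truncation *)

Section Truncation.
Context (R : realType).

Definition truncate (p x : R) : R := if `|x| <= p then x else 0.

Lemma measurable_truncate p : measurable_fun setT (truncate p).
Proof.
apply: measurable_fun_ifT => //; apply: measurable_fun_ler => //; exact: normr_measurable.
Qed.

Lemma norm_truncate_le p x : 0 <= p -> `|truncate p x| <= p.
Proof. by rewrite /truncate; case: ifP => // _; rewrite normr0. Qed.

Lemma norm_truncate_le_norm p x : `|truncate p x| <= `|x|.
Proof. by rewrite /truncate; case: ifP => // _; rewrite normr0. Qed.

Variables (p delta : R).
Hypotheses (p1 : 1 <= p) (delta0 : 0 < delta) (delta1 : delta <= 1).

Let p_gt0 : 0 < p. Proof. exact: lt_le_trans p1. Qed.

(** On [|x| <= p], [x^4 = |x|^(2 - delta) |x|^(2 + delta)] and the first factor is at most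
    [p^(2 - delta)]. It is written [p^3 / p^(1 + delta)] because [p^3] later cancels against the
    normalisation [p^-4] and a sum of order [p]. *)
Lemma truncate_pow4_le x :
  truncate p x ^+ 4 <= p ^+ 3 / p `^ (1 + delta) * `|x| `^ (2 + delta).
Proof.
have [->|x0] := eqVneq x 0.
  rewrite /truncate; case: ifP => _; rewrite expr0n/=;
  by rewrite !mulr_ge0 ?invr_ge0 ?powR_ge0 ?exprn_ge0 ?ltW.
rewrite /truncate; case: ifPn => xp; last first.
  by rewrite expr0n/= !mulr_ge0 ?invr_ge0 ?powR_ge0 ?exprn_ge0 ?ltW.
have nx0 : 0 < `|x| by rewrite normr_gt0.
have -> : x ^+ 4 = `|x| `^ (2 - delta) * `|x| `^ (2 + delta).
  rewrite -powRD; last by rewrite (lt0r_neq0 nx0) implybT.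
  rewrite (_ : 2 - delta + (2 + delta) = 4%:R); last by ring.
  by rewrite powR_mulrn// -normrX ger0_norm ?exprn_even_ge0.
have -> : p ^+ 3 / p `^ (1 + delta) = p `^ (2 - delta).
  rewrite -powR_mulrn ?(ltW p_gt0)// -powRB; first by congr (_ `^ _); ring.
  by rewrite (lt0r_neq0 p_gt0) implybT.
apply: ler_wpM2r; first exact: powR_ge0.
apply: ge0_ler_powR; rewrite ?nnegrE ?(ltW p_gt0)//; move: delta1; lra.
Qed.

(** Where the difference is not 0, [|x| > p] and so [(|x| / p)^(1 + delta) >= 1]. *)
Lemma sub_truncate_le x :
  `|x - truncate p x| <= (p `^ (1 + delta))^-1 * `|x| `^ (2 + delta).
Proof.
rewrite /truncate; case: ifPn => [_|].
  by rewrite subrr normr0 mulr_ge0 ?invr_ge0 ?powR_ge0.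
rewrite -ltNge => px; rewrite subr0.
have nx0 : 0 < `|x| by exact: lt_trans px.
rewrite mulrC ler_pdivlMr ?powR_gt0//.
have -> : `|x| `^ (2 + delta) = `|x| * `|x| `^ (1 + delta).
  rewrite -[X in X * _]powRr1// -powRD; first by congr (_ `^ _); ring.
  by rewrite (lt0r_neq0 nx0) implybT.
apply: ler_wpM2l => //; apply: ge0_ler_powR; rewrite ?nnegrE ?ltW//; move: delta0; lra.
Qed.

Lemma pow_le_1DpowR (x : R) (k : nat) (r : R) : k%:R <= r ->
  `|x| ^+ k <= 1 + `|x| `^ r.
Proof.
move=> kr; have [x1|x1] := leP `|x| 1.
  by rewrite (@le_trans _ _ 1)// ?exprn_ile1// lerDl powR_ge0.
rewrite -powR_mulrn// (@le_trans _ _ (`|x| `^ r))//; last by rewrite lerDr.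
by apply: ler_powR => //; exact: ltW.
Qed.

Section independent.
Context (d : measure_display) (T : measurableType d) (P : probability T R)
  (I : eqType) (z : I -> T -> R) (v : I -> R) (C B K : R).
Hypothesis mz : forall i, measurable_fun setT (z i).
Hypothesis iz : mutually_independent P setT z.
Hypothesis z0 : forall i, mean P (z i) = 0.
Hypothesis zi : forall i, integ P (fun w => `|z i w| `^ (2 + delta)).
Hypothesis zC : forall i, mean P (fun w => `|z i w| `^ (2 + delta)) <= C.
Hypothesis v0 : forall i, 0 <= v i.
Hypothesis vB : forall i, v i <= B.
Hypotheses (K0 : 0 <= K) (C0 : 0 <= C) (B0 : 0 <= B).

(** The weighted variable is truncated, not [z i] alone, so that each kept value is at most 1 in
    size after division by [p]. *)
Let y i w := truncate p (v i * z i w).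

Let my i : measurable_fun setT (y i).
Proof.
apply: measurableT_comp; first exact: measurable_truncate.
exact: measurable_funM.
Qed.

Let Ly i : L4 P (y i).
Proof.
by apply: (@L4_bounded _ _ _ _ _ p) => // w; apply: norm_truncate_le; exact: ltW.
Qed.

Let a := p `^ (1 + delta).

Let a0 : 0 < a. Proof. exact: powR_gt0. Qed.

Let normv i w :
  `|v i * z i w| `^ (2 + delta) = v i `^ (2 + delta) * `|z i w| `^ (2 + delta).
Proof. by rewrite normrM (ger0_norm (v0 i)) powRM. Qed.

Let zi1 i : integ P (z i).
Proof.
apply: (integ_dom _ (integD (integ_cst P 1) (zi i))) => // w.
by rewrite -[leLHS]expr1 pow_le_1DpowR//; move: delta0; lra.
Qed.

Let mean_y4 i : mean P (fun w => y i w ^+ 4) <=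
  p ^+ 3 / a * (v i `^ (2 + delta) * C).
Proof.
apply: (@le_trans _ _ (mean P (fun w =>
    (p ^+ 3 / a * v i `^ (2 + delta)) * `|z i w| `^ (2 + delta)))).
  apply: le_mean; [by case: (Ly i)|exact: integZ|move=> w].
  by rewrite -mulrA -normv; exact: truncate_pow4_le.
rewrite meanZ// -mulrA; apply: ler_wpM2l.
  by rewrite mulr_ge0 ?invr_ge0 ?exprn_ge0 ?ltW.
by apply: ler_wpM2l; rewrite ?powR_ge0.
Qed.

Let mean_y2 i : mean P (fun w => y i w ^+ 2) <= v i ^+ 2 * (1 + C).
Proof.
apply: (@le_trans _ _ (mean P (fun w =>
    v i ^+ 2 * (1 + `|z i w| `^ (2 + delta))))).
  apply: le_mean; [exact: L4_sqr| |move=> w].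
    by apply: integZ; apply: integD => //; exact: integ_cst.
  apply: (@le_trans _ _ (`|v i * z i w| ^+ 2)).
    rewrite -[leLHS]ger0_norm ?sqr_ge0// normrX lerXn2r ?nnegrE//.
    exact: norm_truncate_le_norm.
  rewrite normrM (ger0_norm (v0 i)) exprMn ler_wpM2l ?sqr_ge0//.
  by rewrite pow_le_1DpowR//; move: delta0; lra.
rewrite meanZ ?meanD ?mean_cst//; try by integ_auto.
by rewrite ler_wpM2l ?sqr_ge0// lerD2l.
Qed.

(** Truncation destroys centring, so both parts are recentred; the two subtracted means cancel
    because [v i * z i] has mean 0. *)
Definition small_part (s : seq I) w :=
  p^-1 * \sum_(i <- s) (y i w - mean P (y i)).

Definition large_part (s : seq I) w :=
  p^-1 * \sum_(i <- s) ((v i * z i w - y i w) - mean P (fun w => v i * z i w - y i w)).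

Lemma small_partD s w :
  p^-1 * \sum_(i <- s) v i * z i w = small_part s w + large_part s w.
Proof.
rewrite -mulrDr -big_split /=; congr (_ * _); apply: eq_bigr => i _.
rewrite meanB ?meanZ ?z0//; [ring|exact: integZ|exact: L4_integ].
Qed.

Lemma L4_small_part s : L4 P (small_part s).
Proof.
apply: L4Z; apply: L4_sum => i; apply: L4D => //; exact: L4_cst.
Qed.

Let integ_yB i : integ P (fun w => v i * z i w - y i w).
Proof. by apply: integB; [exact: integZ|exact: L4_integ]. Qed.

Lemma integ_large_part s : integ P (large_part s).
Proof.
apply: integZ; apply: integ_sum => i; apply: integB => //; exact: integ_cst.
Qed.

(** Maximum and sum of the weights combine through [v^(2 + delta) <= B^(1 + delta) v]. *)
Let sum_vq s : \sum_(i <- s) v i <= K * p ->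
  \sum_(i <- s) v i `^ (2 + delta) <= B `^ (1 + delta) * (K * p).
Proof.
move=> sv; apply: (@le_trans _ _ (\sum_(i <- s) B `^ (1 + delta) * v i)).
  apply: ler_sum => i _; have [->|vi0] := eqVneq (v i) 0.
    by rewrite powR0 ?mulr0//; move: delta0; lra.
  rewrite (_ : 2 + delta = (1 + delta) + 1); last by ring.
  rewrite powRD ?vi0 ?implybT// powRr1//; apply: ler_wpM2r => //.
  apply: ge0_ler_powR; rewrite ?nnegrE//; first by move: delta0; lra.
by rewrite -mulr_sumr ler_wpM2l ?powR_ge0.
Qed.

(** Recentring at most doubles a first moment, whence the 2; the normalisation [p^-1] cancels the
    [p] in the sum of the weights and leaves the tail bound [p^-(1 + delta)]. *)
Lemma mean_large_part s : \sum_(i <- s) v i <= K * p ->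
  mean P (fun w => `|large_part s w|) <=
  2 * K * B `^ (1 + delta) * C / p `^ (1 + delta).
Proof.
move=> sv.
have iyB i : integ P (fun w => (v i * z i w - y i w) -
    mean P (fun w => v i * z i w - y i w)).
  by apply: integB => //; exact: integ_cst.
have h i : mean P (fun w => `|v i * z i w - y i w|) <=
    a^-1 * (v i `^ (2 + delta) * C).
  apply: (@le_trans _ _ (mean P (fun w =>
    (a^-1 * v i `^ (2 + delta)) * `|z i w| `^ (2 + delta)))).
    apply: le_mean; [exact: integ_norm|exact: integZ|move=> w].
    by rewrite -mulrA -normv; exact: sub_truncate_le.
  rewrite meanZ// -mulrA; apply: ler_wpM2l; first by rewrite invr_ge0 ltW.
  by apply: ler_wpM2l; rewrite ?powR_ge0.
apply: (@le_trans _ _ (mean P (fun w => p^-1 * \sum_(i <- s)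
    (`|v i * z i w - y i w| + mean P (fun w => `|v i * z i w - y i w|))))).
  apply: le_mean.
  - exact: (integ_norm (integ_large_part s)).
  - apply: integZ; apply: integ_sum => i; apply: integD; last exact: integ_cst.
    exact: integ_norm.
  - move=> w; rewrite normrM ger0_norm ?invr_ge0 ?(ltW p_gt0)//.
    apply: ler_wpM2l; first by rewrite invr_ge0 ltW.
    apply: (le_trans (ler_norm_sum _ _ _)); apply: ler_sum => i _.
    by apply: (le_trans (ler_normB _ _)); rewrite lerD2l le_norm_mean.
rewrite meanZ; last first.
  apply: integ_sum => i; apply: integD; last exact: integ_cst.
  exact: integ_norm.
rewrite mean_sum; last first.
  move=> i; apply: integD; last exact: integ_cst; exact: integ_norm.
apply: (@le_trans _ _ (p^-1 * \sum_(i <- s) (2 * a^-1 * C) * v i `^ (2 + delta))).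
  apply: ler_wpM2l; first by rewrite invr_ge0 ltW.
  apply: ler_sum => i _; rewrite meanD ?mean_cst; [|exact: integ_norm|exact: integ_cst].
  by have := h i; lra.
rewrite -mulr_sumr.
have := sum_vq sv; set W := \sum_(i <- s) _ => hW.
rewrite (_ : 2 * K * B `^ (1 + delta) * C / _ =
  p^-1 * (2 * a^-1 * C * (B `^ (1 + delta) * (K * p)))); last first.
  by rewrite -/a; field; rewrite !gt_eqF.
apply: ler_wpM2l; first by rewrite invr_ge0 ltW.
by apply: ler_wpM2l => //; rewrite !mulr_ge0 ?invr_ge0 ?(ltW a0).
Qed.

(** The fourth powers contribute [p^-4 p^(2 - delta) p]. The square of the summed variances
    contributes [p^-4 p^2], within the same bound because [delta <= 1]. The 16 is the 8 of
    [(t - u)^4 <= 8 (t^4 + u^4)], doubled by Jensen. *)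
Lemma mean_small_part s : uniq s -> \sum_(i <- s) v i <= K * p ->
  mean P (fun w => small_part s w ^+ 4) <=
  (16 * K * B `^ (1 + delta) * C + 3 * ((1 + C) * (B * K)) ^+ 2)
    / p `^ (1 + delta).
Proof.
move=> us sv.
pose x i w := y i w - mean P (y i).
have Lx i : L4 P (x i) by apply: L4D => //; exact: L4_cst.
have x0 i : mean P (x i) = 0.
  by rewrite meanB ?mean_cst ?subrr//; [exact: L4_integ|exact: integ_cst].
have ix : mutually_independent P setT x.
  apply: (mutually_independent_comp
    (phi := fun i t => truncate p (v i * t) - mean P (y i))) => // i.
  apply: measurable_funB => //; apply: measurableT_comp.
    exact: measurable_truncate.
  exact: measurable_funM.
have x2 i : mean P (fun w => x i w ^+ 2) <= v i ^+ 2 * (1 + C).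
  apply: le_trans (mean_y2 i).
  rewrite (_ : (fun w => _) = fun w =>
    (y i w ^+ 2 + (- 2 * mean P (y i)) * y i w) + mean P (y i) ^+ 2); last first.
    by apply/funext => w; rewrite /x; ring.
  have y1 := L4_integ (Ly i); have y2 := L4_sqr (Ly i).
  rewrite meanD ?meanD ?meanZ ?mean_cst//; try by integ_auto.
  by have := sqr_ge0 (mean P (y i)); lra.
have x4 i : mean P (fun w => x i w ^+ 4) <= 16 * (p ^+ 3 / a * (v i `^ (2 + delta) * C)).
  have y1 := L4_integ (Ly i); have y2 := L4_sqr (Ly i); have [_ y4] := Ly i.
  apply: (@le_trans _ _ (mean P (fun w => 8 * (y i w ^+ 4 + mean P (y i) ^+ 4)))).
    apply: le_mean; [by case: (Lx i)|by integ_auto|move=> w].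
    rewrite /x; move: (y i w) (mean P (y i)) => t u.
    have := sqr_ge0 (t ^+ 2 - u ^+ 2).
    have := mulr_ge0 (sqr_ge0 (t - u)) (sqr_ge0 (t + u)).
    have := sqr_ge0 ((t + u) ^+ 2).
    have := mulr_ge0 (sqr_ge0 (t + u)) (addr_ge0 (sqr_ge0 t) (sqr_ge0 u)).
    lra.
  rewrite meanZ ?meanD ?mean_cst//; try by integ_auto.
  (* Jensen in two squarings: [(E y)^2 <= E y^2], then [(E y^2)^2 <= E y^4] by Cauchy-Schwarz
     against 1. *)
  have : mean P (y i) ^+ 4 <= mean P (fun w => y i w ^+ 4).
    have := mean_sqr_le (Ly i).
    have := mean_CS (Ly i) (L4_cst P 1).
    rewrite (_ : (fun w => _ ^+ 2 * _) = fun w => y i w ^+ 2); last first.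
      by apply/funext => w; rewrite expr1n mulr1.
    rewrite (_ : (fun _ : T => 1 ^+ 4) = fun=> 1); last first.
      by apply/funext => w; rewrite expr1n.
    rewrite mean_cst mulr1 => h1 h2; apply: le_trans h1.
    rewrite -[4%N]/(2 * 2)%N exprM.
    by rewrite lerXn2r ?nnegrE ?sqr_ge0// (le_trans _ h2) ?sqr_ge0.
  by have := mean_y4 i; lra.
rewrite /small_part; under eq_fun do rewrite exprMn.
rewrite meanZ; last by have [_] := L4_sum s Lx.
have hp : 0 <= p^-1 ^+ 4 by rewrite exprn_even_ge0.
apply: (le_trans (ler_wpM2l hp (mean_sum_pow4 Lx ix x0 us))).
have h4 : \sum_(i <- s) mean P (fun w => x i w ^+ 4) <=
    16 * (p ^+ 3 / a) * C * (B `^ (1 + delta) * (K * p)).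
  apply: (@le_trans _ _ (16 * (p ^+ 3 / a) * C * \sum_(i <- s) v i `^ (2 + delta))).
    by rewrite mulr_sumr; apply: ler_sum => i _; have := x4 i; lra.
  apply: ler_wpM2l; last exact: sum_vq.
  by rewrite !mulr_ge0 ?invr_ge0 ?exprn_ge0 ?(ltW a0) ?(ltW p_gt0).
have h2 : \sum_(i <- s) mean P (fun w => x i w ^+ 2) <= (1 + C) * (B * (K * p)).
  apply: (@le_trans _ _ ((1 + C) * (B * \sum_(i <- s) v i))).
    rewrite !mulr_sumr; apply: ler_sum => i _; apply: (le_trans (x2 i)).
    rewrite mulrC ler_wpM2l ?addr_ge0// expr2 ler_wpM2r//.
  by rewrite !ler_wpM2l ?addr_ge0.
have h22 : (\sum_(i <- s) mean P (fun w => x i w ^+ 2)) ^+ 2 <=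
    ((1 + C) * (B * (K * p))) ^+ 2.
  rewrite lerXn2r ?nnegrE//; last by rewrite !mulr_ge0 ?addr_ge0 ?(ltW p_gt0).
  by apply: sumr_ge0 => i _; apply: mean_ge0 => w; exact: sqr_ge0.
have ap2 : p ^- 2 <= a^-1.
  rewrite lef_pV2 ?posrE ?exprn_gt0// /a -powR_mulrn ?(ltW p_gt0)//.
  by apply: ler_powR => //; move: delta1; lra.
apply: (@le_trans _ _ (p^-1 ^+ 4 * (16 * (p ^+ 3 / a) * C * (B `^ (1 + delta) * (K * p))
  + 3 * ((1 + C) * (B * (K * p))) ^+ 2))).
  by apply: ler_wpM2l => //; lra.
have -> : p^-1 ^+ 4 * (16 * (p ^+ 3 / a) * C * (B `^ (1 + delta) * (K * p))
    + 3 * ((1 + C) * (B * (K * p))) ^+ 2) =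
    16 * K * B `^ (1 + delta) * C / a + 3 * ((1 + C) * (B * K)) ^+ 2 * p ^- 2.
  by move: (a) a0 (B `^ _) => a' a'0 b; field; rewrite !gt_eqF.
rewrite -/a [leRHS]mulrDl lerD2l; apply: ler_wpM2l => //.
by rewrite mulr_ge0 ?sqr_ge0.
Qed.

End independent.
End Truncation.

(** * Almost sure convergence from summable moments *)

Section AlmostSure.
Context (R : realType) (delta : R).
Hypothesis delta0 : 0 < delta.

(* Telescoping bound for the Riemann series of exponent [1 + delta]. *)
Lemma riemann_telescope (a : R) : 0 < a ->
  delta * ((a + 1) `^ (1 + delta))^-1 <= (a `^ delta)^-1 - ((a + 1) `^ delta)^-1.
Proof.
move=> a0; have b0 : 0 < a + 1 by exact: addr_gt0.
have A0 : 0 < a `^ delta by exact: powR_gt0.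
have B0 : 0 < (a + 1) `^ delta by exact: powR_gt0.
have Bpow : (a + 1) `^ (1 + delta) = (a + 1) * (a + 1) `^ delta.
  by rewrite powRD ?powRr1 ?(ltW b0)// (lt0r_neq0 b0) implybT.
(* The ratio is [expR] of [- delta ln (1 - 1 / (a + 1))]; the tangent-line inequalities for [expR]
   and [ln] give the bound. *)
have ratio : 1 + delta / (a + 1) <= (a + 1) `^ delta / a `^ delta.
  have -> : (a + 1) `^ delta / a `^ delta = expR (delta * (ln (a + 1) - ln a)).
    rewrite mulrBr expRD expRN /powR (gt_eqF b0) (gt_eqF a0).
    by [].
  apply: le_trans (expR_ge1Dx _); rewrite lerD2l; apply: ler_wpM2l; first exact: ltW.
  have /le_ln1Dx : -1 < - (a + 1)^-1.
    by rewrite ltrN2 invf_lt1// ltrDr.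
  have -> : 1 - (a + 1)^-1 = a / (a + 1) by field; rewrite gt_eqF.
  by rewrite ln_div ?posrE//; lra.
rewrite Bpow invfM.
have -> : delta * ((a + 1)^-1 * ((a + 1) `^ delta)^-1) =
  (delta / (a + 1)) * ((a + 1) `^ delta)^-1 by rewrite mulrA.
have -> : (a `^ delta)^-1 - ((a + 1) `^ delta)^-1 =
  ((a + 1) `^ delta / a `^ delta - 1) * ((a + 1) `^ delta)^-1.
  by field; rewrite !gt_eqF.
apply: ler_wpM2r; first by rewrite invr_ge0 ltW.
by lra.
Qed.

(** Starting at [M.+2] keeps the left end [m + M.+1] of each telescoping step positive, and the
    first telescoped term at most 1 whatever [M] is. *)
Lemma sum_riemann_le (M N : nat) :
  \sum_(m < N) ((m + M.+2)%:R `^ (1 + delta))^-1 <= delta^-1 :> R.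
Proof.
suff : delta * \sum_(m < N) ((m + M.+2)%:R `^ (1 + delta))^-1 <=
    (M.+1%:R `^ delta)^-1 - ((N + M.+1)%:R `^ delta)^-1 :> R.
  move=> h; rewrite -[leRHS]mul1r ler_pdivlMr// mulrC (le_trans h)//.
  apply: (@le_trans _ _ (M.+1%:R `^ delta)^-1).
    by rewrite gerBl invr_ge0 powR_ge0.
  rewrite invf_le1 ?powR_gt0// (@le_trans _ _ (1 `^ delta))//.
    by rewrite powR1.
  by apply: ge0_ler_powR; rewrite ?nnegrE ?(ltW delta0)// ler1n.
elim: N => [|N ih]; first by rewrite big_ord0 mulr0 add0n subrr.
rewrite big_ord_recr /= mulrDr.
have a0 : 0 < (N + M.+1)%:R :> R by rewrite ltr0n addnS.
have := riemann_telescope a0.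
rewrite natr1 -addnS addSnnS.
by move: ih; lra.
Qed.

Context (d : measure_display) (T : measurableType d) (P : probability T R).

(** The series of the [Y m], from some index on, has finite expectation, so it is finite almost
    surely and its terms tend to 0. This takes the place of Borel-Cantelli. *)
Lemma ae_cvg0 (Y : nat -> T -> R) (C : R) (M : nat) :
  (forall m w, 0 <= Y m w) ->
  (forall m, (M <= m)%N -> integ P (Y m) /\
     mean P (Y m) <= C / m%:R `^ (1 + delta)) ->
  {ae P, forall w, (Y m w) @[m --> \oo] --> (0 : R)}.
Proof.
move=> Y0 YC.
(* The shift skips the sizes without a bound and lands on the indices of [sum_riemann_le]. *)
pose Z m w := Y (m + M.+2)%N w.
have ZC m : integ P (Z m) /\ mean P (Z m) <= C / (m + M.+2)%:R `^ (1 + delta).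
  by apply: YC; rewrite !addnS -addSn -addSn leq_addl.
have C0 : 0 <= C.
  have [_ h] := ZC 0%N; have := le_trans (mean_ge0 P (Y0 _)) h.
  by rewrite pmulr_lge0// invr_gt0 powR_gt0// ltr0n.
have mZ m : measurable_fun setT (fun w => (Z m w)%:E).
  by apply/measurable_EFinP; exact: (integ_measurable (proj1 (ZC m))).
have Z0 m w : (0 <= (Z m w)%:E)%E by rewrite lee_fin Y0.
pose F w := (\sum_(m <oo) (Z m w)%:E)%E.
have F0 w : (0 <= F w)%E by apply: nneseries_ge0.
have mF : measurable_fun setT F by apply: ge0_emeasurable_sum.
have iF : P.-integrable setT F.
  apply/integrableP; split => //.
  under eq_integral do rewrite gee0_abs//.
  rewrite integral_nneseries//.
  apply: (@le_lt_trans _ _ (C / delta)%:E); last exact: ltry.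
  apply: lime_le; first by apply: is_cvg_nneseries => n _ _; exact: integral_ge0.
  apply: nearW => N; rewrite big_mkord.
  under eq_bigr do rewrite -EFin_mean ?(proj1 (ZC _))//.
  rewrite sumEFin lee_fin.
  apply: (@le_trans _ _ (\sum_(m < N) C * ((m + M.+2)%:R `^ (1 + delta))^-1)).
    by apply: ler_sum => m _; case: (ZC m).
  by rewrite -mulr_sumr ler_wpM2l// sum_riemann_le.
have := integrable_ae measurableT iF.
apply: filterS => w /(_ I) Fw.
have Foo : (\sum_(0 <= m <oo) (Z m w)%:E < +oo)%E.
  by rewrite -ge0_fin_numE; [exact: Fw|exact: (F0 w)].
(* A term is dominated by the tail that starts with it, and the tails of a finite sum tend to 0. *)
have tail := nneseries_tail_cvg Foo (fun k _ => Z0 k w).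
have Zw : ((Z m w)%:E @[m --> \oo] --> 0%:E)%E.
  apply: (squeeze_cvge _ (cvg_cst _) tail); apply: nearW => m.
  rewrite Z0/=.
  apply: le_trans (nneseries_lim_ge m.+1 _) => //.
  by rewrite big_nat1.
rewrite -(cvg_shiftn M.+2).
exact: (fine_cvg Zw).
Qed.

Lemma ae_cvg0_pow4 (Y : nat -> T -> R) (C : R) (M : nat) :
  (forall m, (M <= m)%N -> L4 P (Y m) /\
     mean P (fun w => Y m w ^+ 4) <= C / m%:R `^ (1 + delta)) ->
  {ae P, forall w, (Y m w) @[m --> \oo] --> (0 : R)}.
Proof.
move=> YC.
have : {ae P, forall w, (Y m w ^+ 4) @[m --> \oo] --> (0 : R)}.
  apply: (@ae_cvg0 _ C M).
  - by move=> m w; rewrite exprn_even_ge0.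
  - by move=> m /YC[[_ ?] ?].
apply: filterS => w /cvgr0Pnorm_lt Yw; apply/cvgr0Pnorm_lt => e e0.
near=> m; have : `|Y m w ^+ 4| < e ^+ 4.
  by near: m; apply: Yw; exact: exprn_gt0.
by rewrite normrX ltr_pXn2r ?nnegrE// ltW.
Unshelve. all: by end_near. Qed.

End AlmostSure.

(** * Matrices *)

Section MatrixSums.
Context (R : realType).

Definition frob2 (m q : nat) (M : 'M[R]_(m, q)) : R := \sum_i \sum_j M i j ^+ 2.

Lemma frob2_ge0 m q (M : 'M[R]_(m, q)) : 0 <= frob2 M.
Proof. by do 2 (apply: sumr_ge0 => ? _); exact: sqr_ge0. Qed.

Lemma ntrE m q (M N : 'M[R]_(m, q)) :
  ntr M N = (m%:R * q%:R)^-1 * \sum_i \sum_j M i j * N i j.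
Proof.
congr (_ * _); apply: eq_bigr => i _; rewrite mxE.
by apply: eq_bigr => j _; rewrite mxE.
Qed.

Lemma ntr_frob2 m q (M : 'M[R]_(m, q)) : ntr M M = (m%:R * q%:R)^-1 * frob2 M.
Proof. by rewrite ntrE. Qed.

Lemma ntr_ge0 m q (M : 'M[R]_(m, q)) : 0 <= ntr M M.
Proof. by rewrite ntr_frob2 mulr_ge0 ?frob2_ge0// invr_ge0 mulr_ge0. Qed.

Lemma ntrC m q (M N : 'M[R]_(m, q)) : ntr M N = ntr N M.
Proof.
rewrite !ntrE; congr (_ * _); apply: eq_bigr => i _.
by apply: eq_bigr => j _; rewrite mulrC.
Qed.

Lemma ntrDl m q (M N K : 'M[R]_(m, q)) : ntr (M + N) K = ntr M K + ntr N K.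
Proof. by rewrite /ntr mulmxDl mxtraceD mulrDr. Qed.

Lemma mxtrace_mul_trmx m q r (S : 'M[R]_(m, r)) (F : 'M[R]_(r, q)) (M : 'M[R]_(m, q)) :
  \tr (S *m F *m M^T) = \tr (F *m (S^T *m M)^T).
Proof. by rewrite -mulmxA mxtrace_mulC trmx_mul trmxK mulmxA. Qed.

(** Lagrange's identity, with each unordered pair counted twice. *)
Lemma sum_CauchySchwarz (I : finType) (a b : I -> R) :
  (\sum_i a i * b i) ^+ 2 <= (\sum_i a i ^+ 2) * (\sum_i b i ^+ 2).
Proof.
have : 0 <= \sum_i \sum_j (a i * b j - a j * b i) ^+ 2.
  by do 2 (apply: sumr_ge0 => ? _); exact: sqr_ge0.
have -> : \sum_i \sum_j (a i * b j - a j * b i) ^+ 2 =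
  \sum_i \sum_j (a i ^+ 2 * b j ^+ 2) + \sum_i \sum_j (a j ^+ 2 * b i ^+ 2)
  - 2 * \sum_i \sum_j ((a i * b i) * (a j * b j)).
  rewrite mulr_sumr -big_split -sumrB; apply: eq_bigr => i _ /=.
  by rewrite mulr_sumr -big_split -sumrB; apply: eq_bigr => j _ /=; ring.
rewrite [X in _ + X - _]exchange_big /= -!big_distrlr/= -expr2.
lra.
Qed.

Lemma frob2_mul m r q (S : 'M[R]_(m, r)) (M : 'M[R]_(r, q)) :
  frob2 (S *m M) <= frob2 S * frob2 M.
Proof.
rewrite /frob2 [\sum_(i < r) _]exchange_big big_distrlr /=.
apply: ler_sum => i _; apply: ler_sum => j _; rewrite mxE.
exact: sum_CauchySchwarz.
Qed.

Lemma frob2_mxtrace m q (S : 'M[R]_(m, q)) : frob2 S = \tr (S *m S^T).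
Proof.
apply: eq_bigr => i _; rewrite mxE; apply: eq_bigr => j _.
by rewrite mxE expr2.
Qed.

Lemma frob2_tr m q (S : 'M[R]_(m, q)) : frob2 S^T = frob2 S.
Proof. by rewrite !frob2_mxtrace trmxK mxtrace_mulC. Qed.

Lemma sum_triple (n m q : nat) (f : 'I_n * 'I_m * 'I_q -> R) :
  \sum_t f t = \sum_k \sum_i \sum_j f (k, i, j).
Proof. by rewrite pair_bigA /= pair_bigA /=; apply: eq_bigr => -[[]]. Qed.

Section sample_mean.
Context (n m q : nat) (x : 'I_n * 'I_m * 'I_q -> R).

(** One finite type of triples (replicate, row, column) indexes all replicates, so that a form in
    the matrix entries is a form in a single independent family. *)
Definition sample_mean : 'M[R]_(m, q) :=
  \matrix_(i, j) (n%:R^-1 * \sum_k x (k, i, j)).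

Lemma sum_sample_mean (H : 'M[R]_(m, q)) :
  \sum_t (n%:R^-1 * H t.1.2 t.2) * x t =
  \sum_i \sum_j sample_mean i j * H i j.
Proof.
rewrite sum_triple exchange_big /=; apply: eq_bigr => i _.
rewrite exchange_big /=; apply: eq_bigr => j _.
by rewrite mxE [RHS]mulrAC mulr_sumr.
Qed.

(** Coefficient of [x t * x u] in [tr (G F F^T)] for the sample mean [F]: left multiplication mixes
    rows only, so the columns must agree, and replicates enter through [n^-2] alone. *)
Definition gram_coef (G : 'M[R]_m) (t u : 'I_n * 'I_m * 'I_q) : R :=
  n%:R^-1 ^+ 2 * (G t.1.2 u.1.2 * (t.2 == u.2)%:R).

Lemma tr_gram_sample_mean (S : 'M[R]_m) :
  \tr (S *m sample_mean *m (S *m sample_mean)^T) =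
  \sum_t \sum_u gram_coef (S^T *m S) t u * x t * x u.
Proof.
rewrite mxtrace_mul_trmx mulmxA; set G := S^T *m S.
transitivity (\sum_t (n%:R^-1 * (G *m sample_mean) t.1.2 t.2) * x t).
  rewrite sum_sample_mean; apply: eq_bigr => i _; rewrite mxE.
  by apply: eq_bigr => j _; rewrite [X in _ * X]mxE.
apply: eq_bigr => t _.
have -> : (G *m sample_mean) t.1.2 t.2 = 
   \sum_u (n%:R^-1 * (\matrix_(l, j) (G t.1.2 l * (t.2 == j)%:R)) u.1.2 u.2) * x u.
  rewrite sum_sample_mean mxE; apply: eq_bigr => l _.
  rewrite (bigD1 t.2) //= big1 ?addr0.
    by rewrite [X in _ = _ * X]mxE eqxx mulr1 mulrC.
  by move=> j jt; rewrite [X in _ * X]mxE eq_sym (negbTE jt) !mulr0.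
rewrite mulr_sumr mulr_suml; apply: eq_bigr => u _.
by rewrite mxE /gram_coef; ring.
Qed.

End sample_mean.

(** The column constraint leaves one factor [q] instead of [q^2], the gain behind the fourth moment
    [O(q^-2)] of the off-diagonal chaos. The [n^2] pairs of replicates are absorbed by [n^-4]. *)
Lemma sum_gram_coef_sqr_le (n m q : nat) (G : 'M[R]_m) : (0 < n)%N ->
  \sum_(t : 'I_n * 'I_m * 'I_q) \sum_(u | u != t) gram_coef G t u ^+ 2 <=
  q%:R * frob2 G.
Proof.
move=> n0; have n1 : n%:R^-1 ^+ 2 <= 1 :> R.
  by rewrite exprn_ile1// invf_le1 ?ltr0n// ler1n.
apply: (@le_trans _ _ (\sum_(t : 'I_n * 'I_m * 'I_q) \sum_u gram_coef G t u ^+ 2)).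
  apply: ler_sum => t _; rewrite [leRHS](bigID (fun u => u != t)) /=.
  by rewrite lerDl; apply: sumr_ge0 => u _; exact: sqr_ge0.
have coefE (t : 'I_n * 'I_m * 'I_q) : \sum_u gram_coef G t u ^+ 2 =
    n%:R * n%:R^-1 ^+ 4 * \sum_l G t.1.2 l ^+ 2.
  rewrite sum_triple /=.
  transitivity (\sum_(k < n) n%:R^-1 ^+ 4 * \sum_l G t.1.2 l ^+ 2); last first.
    by rewrite sumr_const card_ord -[LHS]mulr_natl mulrA.
  apply: eq_bigr => k _.
  rewrite mulr_sumr; apply: eq_bigr => l _.
  rewrite (bigD1 t.2) //= big1 ?addr0.
    by rewrite /gram_coef /= eqxx mulr1 exprMn -exprM.
  by move=> j0 jt; rewrite /gram_coef /= eq_sym (negbTE jt) !mulr0 expr0n.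
under eq_bigr => t _ do rewrite coefE.
rewrite -mulr_sumr sum_triple /=.
rewrite [X in _ * X](_ : _ = n%:R * (q%:R * frob2 G)); last first.
  rewrite sumr_const card_ord mulr_natl; congr (_ *+ _).
  rewrite /frob2 mulr_sumr; apply: eq_bigr => i _.
  by rewrite sumr_const card_ord mulr_natl.
have -> : n%:R * n%:R^-1 ^+ 4 * (n%:R * (q%:R * frob2 G)) =
    n%:R^-1 ^+ 2 * (q%:R * frob2 G) :> R.
  by field; rewrite pnatr_eq0 -lt0n.
by rewrite ler_piMl// mulr_ge0// frob2_ge0.
Qed.

End MatrixSums.

(** * Transfer of laws, independence and growth rates to the matrix entries *)

Lemma idist_mean (R : realType) (d : measure_display) (T : measurableType d)
    (P : probability T R) (f g : T -> R) (phi : R -> R) :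
  measurable_fun setT f -> measurable_fun setT g -> measurable_fun setT phi ->
  (forall r, 0 <= phi r) -> identically_distributed P f g ->
  mean P (fun w => phi (f w)) = mean P (fun w => phi (g w)).
Proof.
move=> mf mg mphi phi0 fg.
have mEphi : measurable_fun setT (EFin \o phi) by exact/measurable_EFinP.
rewrite /mean /Rintegral; congr fine.
rewrite -[LHS](ge0_integral_pushforward mf P measurableT mEphi); last first.
  by move=> r _; rewrite lee_fin.
rewrite -[RHS](ge0_integral_pushforward mg P measurableT mEphi); last first.
  by move=> r _; rewrite lee_fin.
by apply: eq_measure_integral => B mB _; exact: fg.
Qed.

(** Passes from the entries indexed by triples of naturals to a finite index type, where sums run
    over all indices. *)
Lemma mutually_independent_inj (R : realType) (d : measure_display)
    (T : measurableType d) (P : probability T R) (I : eqType) (J : finType)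
    (S : set I) (X : I -> T -> R) (f : J -> I) :
  injective f -> (forall j, S (f j)) -> mutually_independent P S X ->
  mutually_independent P setT (fun j => X (f j)).
Proof.
move=> f_inj Sf iX s us _ B mB.
(* Test sets are carried along [f], with [setT] off its range; injectivity makes the picked preimage
   unique. *)
pose B' t := if [pick j | f j == t] is Some j then B j else setT.
have B'f j : B' (f j) = B j.
  rewrite /B'; case: pickP => [k /eqP/f_inj -> //|/(_ j)].
  by rewrite eqxx.
have mB' t : measurable (B' t) by rewrite /B'; case: pickP.
have usf : uniq (map f s) by rewrite map_inj_uniq.
have sS : {subset map f s <= S} by move=> _ /mapP[j _ ->]; exact/mem_set.
have := iX _ usf sS _ mB'; rewrite big_map.
under [X in _ = X]eq_bigr => j _ do rewrite B'f.
move=> <-; congr (P _); apply/seteqP; split => w /= h.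
  by move=> _ /mapP[j js ->]; rewrite /= B'f; exact: h.
by move=> j js; rewrite -B'f; apply: h; exact: map_f.
Qed.

(** For [|x| <= 1] the base is at most 1; otherwise it is at most [x^2], and the exponent
    [2 (2 + delta)] is at most [4 + eps]. *)
Lemma centered_sqr_powR_le (R : realType) (x delta eps : R) :
  0 < delta -> delta * 2 <= eps ->
  `|x ^+ 2 - 1| `^ (2 + delta) <= 1 + `|x| `^ (4 + eps).
Proof.
move=> d0 de; have x2E : x ^+ 2 = `|x| ^+ 2.
  by rewrite -normrX ger0_norm ?sqr_ge0.
have e0 : 0 <= 2 + delta by lra.
have [x1|x1] := leP `|x| 1.
  apply: (@le_trans _ _ 1); last by rewrite lerDl powR_ge0.
  apply: (@le_trans _ _ (1 `^ (2 + delta))); last by rewrite powR1.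
  apply: ge0_ler_powR; rewrite ?nnegrE//.
  have : `|x| ^+ 2 <= 1 by rewrite exprn_ile1.
  by rewrite -x2E ler_norml => h; have := sqr_ge0 x; move=> h'; apply/andP; lra.
have h : `|x ^+ 2 - 1| <= `|x| `^ 2%:R.
  rewrite powR_mulrn// -x2E ler_norml.
  have : 1 <= `|x| ^+ 2 by rewrite exprn_ege1// ltW.
  by rewrite -x2E => h; apply/andP; lra.
apply: (@le_trans _ _ ((`|x| `^ 2%:R) `^ (2 + delta))).
  by apply: ge0_ler_powR; rewrite ?nnegrE ?powR_ge0.
rewrite -powRrM (@le_trans _ _ (`|x| `^ (4 + eps)))//; last by rewrite lerDr.
by apply: ler_powR; [exact: ltW|lra].
Qed.

(** Eventually [m / p < 2 c], which turns decay in [p] into decay in the summation index [m]. *)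
Lemma eventually_powR_le (R : realType) (p : nat -> nat) (c r : R) :
  0 < c -> 0 <= r ->
  ((fun m : nat => (m%:R / (p m)%:R : R)) @ \oo --> c) ->
  exists M, forall m, (M <= m)%N -> [/\ (0 < m)%N, (0 < p m)%N &
    ((p m)%:R `^ r)^-1 <= (2 * c) `^ r / m%:R `^ r :> R].
Proof.
move=> c0 r0 hp.
have h1 : \forall m \near \oo, (0 : R) < m%:R / (p m)%:R.
  exact: (cvgr_gt _ hp).
have h2 : \forall m \near \oo, (m%:R / (p m)%:R : R) < 2 * c.
  by apply: (cvgr_lt _ hp); lra.
have [M _ hM] : \forall m \near \oo,
    (0 : R) < m%:R / (p m)%:R /\ (m%:R / (p m)%:R : R) < 2 * c.
  by apply: filterS2 h1 h2.
exists M => m /hM[m1 m2].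
(* Division by 0 yields 0, so a positive ratio excludes [p m = 0]. *)
have p0 : (0 < p m)%N.
  by rewrite lt0n; apply: contraTneq m1 => ->; rewrite invr0 mulr0 ltxx.
have p0' : 0 < (p m)%:R :> R by rewrite ltr0n.
have m0 : (0 < m)%N.
  by rewrite lt0n; apply: contraTneq m1 => ->; rewrite mul0r ltxx.
have m0' : 0 < m%:R :> R by rewrite ltr0n.
split=> //; rewrite ler_pdivlMr ?powR_gt0// mulrC ler_pdivrMr ?powR_gt0//.
have c2 : 0 <= 2 * c by rewrite mulr_ge0 ?ltW.
rewrite -powRM// ?(ltW p0')//.
apply: ge0_ler_powR; rewrite ?nnegrE ?(ltW m0')// ?mulr_ge0 ?(ltW p0') ?(ltW c0)//.
by move: m2; rewrite ltr_pdivrMr// => /ltW.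
Qed.

(** * Moment bounds at one matrix size *)

Section FixedSize.
Context (R : realType) (d : measure_display) (T : measurableType d)
  (P : probability T R) (n m q : nat).
Local Notation J := ('I_n * 'I_m * 'I_q)%type.
Context (x : J -> T -> R) (kappa beta : R) (S : 'M[R]_m).
Hypotheses (n0 : (0 < n)%N) (m0 : (0 < m)%N) (q0 : (0 < q)%N).
Hypothesis Lx : forall t, L4 P (x t).
Hypothesis ix : mutually_independent P setT x.
Hypothesis x0 : forall t, mean P (x t) = 0.
Hypothesis x2 : forall t, mean P (fun w => x t w ^+ 2) = 1.
Hypothesis x4 : forall t, mean P (fun w => x t w ^+ 4) <= kappa.
Hypothesis kappa1 : 1 <= kappa.
Hypothesis ST : S^T = S.
Hypothesis Sbeta : \tr (S *m S) <= m%:R * beta.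

Let noise w : 'M[R]_(m, q) := S *m sample_mean (fun t => x t w).
Let all := index_enum J.

Let n0' : 0 < n%:R :> R. Proof. by rewrite ltr0n. Qed.
Let m0' : 0 < m%:R :> R. Proof. by rewrite ltr0n. Qed.
Let q0' : 0 < q%:R :> R. Proof. by rewrite ltr0n. Qed.

Let n1 : n%:R^-1 <= 1 :> R. Proof. by rewrite invf_le1// ler1n. Qed.

Let frob2S : frob2 S = \tr (S *m S). Proof. by rewrite frob2_mxtrace ST. Qed.

Let beta0 : 0 <= beta.
Proof.
by have := le_trans (frob2_ge0 S); rewrite frob2S => /(_ _ Sbeta); rewrite pmulr_rge0.
Qed.

Let lin_coef (M : 'M[R]_(m, q)) (t : J) : R :=
  (m%:R * q%:R)^-1 * (n%:R^-1 * (S^T *m M) t.1.2 t.2).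

Lemma ntr_noiseE M w : ntr (noise w) M = \sum_(t <- all) lin_coef M t * x t w.
Proof.
rewrite /ntr mxtrace_mul_trmx.
transitivity ((m%:R * q%:R)^-1 *
  \sum_t (n%:R^-1 * (S^T *m M) t.1.2 t.2) * x t w).
  rewrite sum_sample_mean; congr (_ * _); apply: eq_bigr => i _.
  by rewrite mxE; apply: eq_bigr => j _; rewrite [X in _ * X]mxE.
by rewrite mulr_sumr; apply: eq_bigr => t _; rewrite mulrA.
Qed.

(** The squared coefficients sum to [(m q)^-2 n^-1] times the squared Frobenius norm of [S^T M];
    that norm is at most [m beta] times [m q b], so the sum is at most [beta b / q]. *)
Lemma mean_ntr_noise_pow4 M b : ntr M M <= b ->
  L4 P (fun w => ntr (noise w) M) /\
  mean P (fun w => ntr (noise w) M ^+ 4) <=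
  (kappa + 3) * (beta * b) ^+ 2 / q%:R ^+ 2.
Proof.
move=> Mb; have b0 : 0 <= b by apply: le_trans Mb; exact: ntr_ge0.
 under eq_fun do rewrite ntr_noiseE.
split; first by apply: L4_sum => t; exact: L4Z.
rewrite (_ : (fun w => _) =
  fun w => (\sum_(t <- all) lin_coef M t * x t w) ^+ 4); last first.
  by apply/funext => w; rewrite ntr_noiseE.
apply: (le_trans (mean_linear_pow4 Lx ix x0 x2 x4 kappa1 (lin_coef M)
  (index_enum_uniq J))).
rewrite -mulrA; apply: ler_wpM2l; first by move: kappa1; lra.
rewrite -expr_div_n lerXn2r// ?nnegrE.
- by apply: sumr_ge0 => t _; exact: sqr_ge0.
- by rewrite mulr_ge0 ?invr_ge0 ?(ltW q0')// mulr_ge0.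
have -> : \sum_(t <- all) lin_coef M t ^+ 2 =
    (m%:R * q%:R)^-2 * n%:R^-1 * frob2 (S^T *m M).
  rewrite sum_triple /lin_coef /= sumr_const card_ord -[LHS]mulr_natl.
  rewrite /frob2 !mulr_sumr; apply: eq_bigr => i _.
  rewrite !mulr_sumr; apply: eq_bigr => j _.
  by field; rewrite !gt_eqF.
have hM : frob2 M <= m%:R * q%:R * b.
  by move: Mb; rewrite ntr_frob2 mulrC ler_pdivrMr ?mulr_gt0// [b * _]mulrC.
have hS : frob2 (S^T *m M) <= m%:R * beta * (m%:R * q%:R * b).
  apply: (le_trans (frob2_mul _ _)); rewrite frob2_tr.
  by apply: ler_pM; rewrite ?frob2_ge0// frob2S.
apply: (@le_trans _ _ ((m%:R * q%:R)^-2 * n%:R^-1 * (m%:R * beta * (m%:R * q%:R * b)))).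
  by apply: ler_wpM2l => //; rewrite mulr_ge0 ?invr_ge0 ?exprn_ge0 ?mulr_ge0 ?ltW.
rewrite (_ : beta * b / q%:R = (m%:R * q%:R)^-2 * (m%:R * beta * (m%:R * q%:R * b))); last first.
  by field; rewrite !gt_eqF.
rewrite mulrAC ler_piMr// mulr_ge0 ?invr_ge0 ?exprn_ge0 ?mulr_ge0 ?(ltW m0') ?(ltW q0')//.
Qed.

Let gram := gram_coef (n := n) (q := q) (S^T *m S).

Definition offdiag_part w := (m%:R * q%:R)^-1 * offdiag_form x gram all w.

(** [(m q)^-4] against the square of [q (m beta)^2] leaves [beta^4 / q^2]. *)
Lemma mean_offdiag_part_pow4 : L4 P offdiag_part /\
  mean P (fun w => offdiag_part w ^+ 4) <=
  offdiag_const kappa * beta ^+ 4 / q%:R ^+ 2.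
Proof.
have LO : L4 P (offdiag_form x gram all).
  exact: (L4_offdiag_form Lx ix _ (index_enum_uniq _)).
split; first exact: L4Z.
rewrite /offdiag_part; under eq_fun do rewrite exprMn.
rewrite meanZ; last by case: LO.
have h := mean_offdiag_pow4 Lx ix x0 x2 x4 kappa1 gram (index_enum_uniq J).
set V := \sum_(i <- _) _ in h.
have V0 : 0 <= V by do 2 (apply: sumr_ge0 => ? _); exact: sqr_ge0.
have VB : V <= q%:R * (m%:R * beta) ^+ 2.
  apply: (le_trans (sum_gram_coef_sqr_le _ _ n0)).
  apply: ler_wpM2l; first exact: ltW.
  apply: (le_trans (frob2_mul _ _)); rewrite frob2_tr -expr2 frob2S.
  rewrite lerXn2r// nnegrE ?mulr_ge0 ?(ltW m0')//.
  by rewrite -frob2S frob2_ge0.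
have K0 : 0 <= offdiag_const kappa.
  by rewrite /offdiag_const !mulr_ge0 ?sqr_ge0//; move: kappa1; lra.
have hp : 0 <= (m%:R * q%:R)^-1 ^+ 4 :> R by rewrite exprn_even_ge0.
apply: (@le_trans _ _ ((m%:R * q%:R)^-1 ^+ 4 *
   (offdiag_const kappa * (q%:R * (m%:R * beta) ^+ 2) ^+ 2))).
  apply: ler_wpM2l => //; apply: (le_trans h); apply: ler_wpM2l => //.
  by rewrite lerXn2r ?nnegrE// mulr_ge0 ?sqr_ge0// ltW.
rewrite le_eqVlt; apply/orP; left; apply/eqP.
by move: (offdiag_const kappa) => K; field; rewrite !gt_eqF.
Qed.

(** Only [m^-1] is absorbed in the weight; the remaining [q^-1] is the normalisation [p^-1] of
    [small_part] and [large_part]. *)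
Definition diag_weight (t : J) : R := m%:R^-1 * gram t t.
Definition centered_sqr (t : J) w : R := x t w ^+ 2 - 1.

Let gramtt (t : J) : gram t t = n%:R^-1 ^+ 2 * \sum_l S l t.1.2 ^+ 2.
Proof.
rewrite /gram /gram_coef eqxx mulr1 mxE; congr (_ * _).
by apply: eq_bigr => l _; rewrite mxE expr2.
Qed.

(** Each of the [n q] pairs of a replicate and a column contributes [n^-2 tr (S S)]. Divided by
    [m q], the total is the centring term [(n m)^-1 tr Sigma] of the third limit. *)
Let sum_gramtt : \sum_(t <- all) gram t t = n%:R^-1 * q%:R * \tr (S *m S).
Proof.
under eq_bigr do rewrite gramtt.
rewrite sum_triple /= sumr_const card_ord -[LHS]mulr_natl.
under eq_bigr => i _ do rewrite sumr_const card_ord -[_ *+ _]mulr_natl.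
rewrite -frob2S -[frob2 S]frob2_tr /frob2.
under [in RHS]eq_bigr => i _ do under eq_bigr => l _ do rewrite mxE.
by rewrite !mulr_sumr; apply: eq_bigr => i _; field; rewrite gt_eqF.
Qed.

Lemma ntr_noise_decomp w :
  ntr (noise w) (noise w) - (n%:R * m%:R)^-1 * \tr (S *m S) =
  offdiag_part w + q%:R^-1 * \sum_(t <- all) diag_weight t * centered_sqr t w.
Proof.
rewrite /ntr tr_gram_sample_mean -/gram.
have -> : \sum_t \sum_u gram t u * x t w * x u w =
    offdiag_form x gram all w + \sum_(t <- all) gram t t * x t w ^+ 2.
  rewrite /offdiag_form -big_split; apply: eq_bigr => t _ /=.
  by rewrite [LHS](bigD1 t)//= addrC; congr (_ + _); ring.
have -> : \sum_(t <- all) diag_weight t * centered_sqr t w =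
    m%:R^-1 * (\sum_(t <- all) gram t t * x t w ^+ 2 - \sum_(t <- all) gram t t).
  rewrite -sumrB mulr_sumr; apply: eq_bigr => t _.
  by rewrite /diag_weight /centered_sqr; ring.
rewrite sum_gramtt /offdiag_part.
by field; rewrite !gt_eqF.
Qed.

Lemma diag_weight_ge0 t : 0 <= diag_weight t.
Proof.
rewrite /diag_weight gramtt; apply: mulr_ge0; first by rewrite invr_ge0 ltW.
apply: mulr_ge0; first exact: sqr_ge0.
by apply: sumr_ge0 => l _; exact: sqr_ge0.
Qed.

Lemma sum_diag_weight_le : \sum_(t <- all) diag_weight t <= beta * q%:R.
Proof.
rewrite /diag_weight -mulr_sumr sum_gramtt.
have h0 : 0 <= \tr (S *m S) by rewrite -frob2S frob2_ge0.
apply: (@le_trans _ _ (m%:R^-1 * (1 * q%:R * (m%:R * beta)))).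
  apply: ler_wpM2l; first by rewrite invr_ge0 ltW.
  by apply: ler_pM => //; rewrite ?mulr_ge0 ?invr_ge0 ?ler_wpM2r// ?ltW.
by rewrite le_eqVlt; apply/orP; left; apply/eqP; field; rewrite gt_eqF.
Qed.

(** A weight is at most [m^-1] times the squared norm of one column of [S], and the full Frobenius
    norm already obeys the bound. *)
Lemma diag_weight_le t : diag_weight t <= beta.
Proof.
rewrite /diag_weight gramtt mulrC ler_pdivrMr// [beta * _]mulrC.
apply: le_trans Sbeta; rewrite -frob2S -frob2_tr.
apply: (@le_trans _ _ (1 * \sum_l S l t.1.2 ^+ 2)).
  apply: ler_wpM2r; first by apply: sumr_ge0 => l _; exact: sqr_ge0.
  by rewrite exprn_ile1// invr_ge0 ltW.
rewrite mul1r /frob2 [leRHS](bigD1 t.1.2)//=.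
rewrite [X in _ <= X + _](eq_bigr (fun l => S l t.1.2 ^+ 2)); last first.
  by move=> l _; rewrite mxE.
by rewrite lerDl; do 2 (apply: sumr_ge0 => ? _); exact: sqr_ge0.
Qed.

End FixedSize.

(** * Constants uniform in the size, and the three limits *)

Unset Implicit Arguments. Set Strict Implicit.

Theorem theorem3 (R : realType) (d : measure_display) (T : measurableType d)
  (P : probability T R)
  (p : nat -> nat) (c : R) (hc : 0 < c)
  (hmp : (fun m : nat => (m%:R / (p m)%:R : R)) @ \oo --> c)
  (A : forall m, 'M[R]_(m, p m))
  (hA0 : forall m (i : 'I_m) (j : 'I_(p m)), 0 <= A m i j)
  (hAb : exists B : R, forall m, ntr (A m) (A m) <= B)
  (Sigma : forall m, 'M[R]_m) (hSig : forall m, posdef (Sigma m))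
  (hSigb : exists B : R, forall m, m%:R^-1 * \tr (Sigma m) <= B)
  (S : forall m, 'M[R]_m)
  (hS : forall m, posdef (S m) /\ S m *m S m = Sigma m)
  (n : nat) (hn : (1 < n)%N)
  (X : nat -> nat -> nat -> nat -> T -> R)
  (hXmeas : forall m k i j, measurable_fun setT (X m k i j))
  (eps : R) (heps : 0 < eps)
  (hXid : forall m k i j m' k' i' j',
     identically_distributed P (X m k i j) (X m' k' i' j'))
  (hXmoment : forall m k i j,
     (\int[P]_w ((`|X m k i j w| `^ (4 + eps))%:E) < +oo)%E)
  (hXmean : forall m k i j, (\int[P]_w (X m k i j w)%:E = 0)%E)
  (hXvar : forall m k i j, (\int[P]_w ((X m k i j w) ^+ 2)%:E = 1)%E)
  (hXind : forall m, mutually_independent P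
     [set t : nat * nat * nat | (t.1.1 < n)%N /\ (t.1.2 < m)%N /\ (t.2 < p m)%N]
     (fun t => X m t.1.1 t.1.2 t.2)) :
  {ae P, forall w,
     (fun m => `| ntr (Abar n A S X m w) (const_mx 1)
                  - ntr (A m) (const_mx 1) |) @ \oo --> (0 : R)} /\
  {ae P, forall w,
     (fun m => `| ntr (Abar n A S X m w) (A m) - ntr (A m) (A m) |)
       @ \oo --> (0 : R)} /\
  {ae P, forall w,
     (fun m => `| ntr (Abar n A S X m w) (Abar n A S X m w) - ntr (A m) (A m)
                  - (n%:R * m%:R)^-1 * \tr (Sigma m) |) @ \oo --> (0 : R)}.
Proof.
have n0 : (0 < n)%N by exact: ltnW.
have [B hB] := hSigb; have [b hb] := hAb.
pose beta := Num.max B 0.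
have beta0 : 0 <= beta by rewrite le_max lexx orbT.
(* [eps / 2] keeps [2 (2 + delta)] at most [4 + eps]; the cap 1 keeps [p^-2] at most
   [p^-(1 + delta)]. *)
pose delta := Num.min (eps / 2) 1.
have delta0 : 0 < delta by rewrite lt_min ltr01 andbT divr_gt0.
have delta1 : delta <= 1 by rewrite ge_min lexx orbT.
have delta_eps : delta * 2 <= eps.
  by rewrite -ler_pdivlMr// ge_min lexx.
have r0 : 0 <= 1 + delta by lra.
have ST m : (S m)^T = S m by have [[]] := hS m.
have SS m : S m *m S m = Sigma m by have [] := hS m.
have Sbeta m : (0 < m)%N -> \tr (S m *m S m) <= m%:R * beta.
  move=> m0; rewrite SS mulrC -ler_pdivrMr ?ltr0n// mulrC.
  by rewrite (le_trans (hB m))// le_max lexx.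
have mpow a : measurable_fun [set: R] (fun r : R => `|r| `^ a).
  apply: (measurableT_comp (measurable_powR a)); exact: normr_measurable.
have Xi m k i j : integ P (fun w => `|X m k i j w| `^ (4 + eps)).
  apply/integrableP; split.
    by apply/measurable_EFinP; exact: (measurableT_comp (mpow (4 + eps))).
  under eq_integral do rewrite /= ger0_norm ?powR_ge0//.
  exact: hXmoment.
(* Any entry serves as reference, as [hXid] compares entries across all sizes and indices. *)
pose C0 := mean P (fun w => `|X 0%N 0%N 0%N 0%N w| `^ (4 + eps)).
have XC0 m k i j : mean P (fun w => `|X m k i j w| `^ (4 + eps)) = C0.
  by apply: (idist_mean (phi := fun r => `|r| `^ (4 + eps))) => // r;
    exact: powR_ge0.
have C00 : 0 <= C0 by apply: mean_ge0 => w; exact: powR_ge0.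
(* One constant for [E x^4] and for [E |x^2 - 1|^(2 + delta)]: both integrands are at most
   [1 + |x|^(4 + eps)]. *)
pose kappa := 1 + C0.
have kappa1 : 1 <= kappa by rewrite lerDl.
have pow4_le m k i j w : X m k i j w ^+ 4 <= 1 + `|X m k i j w| `^ (4 + eps).
  rewrite -[X in X <= _]ger0_norm ?exprn_even_ge0// normrX.
  by apply: pow_le_1DpowR; lra.
have i1 m k i j : integ P (fun w => 1 + `|X m k i j w| `^ (4 + eps)).
  by apply: integD => //; exact: integ_cst.
have LX m k i j : L4 P (X m k i j).
  split => //; apply: (integ_dom _ (i1 m k i j)); first exact: measurable_funX.
  by move=> w; rewrite ger0_norm ?exprn_even_ge0.
pose x m (t : 'I_n * 'I_m * 'I_(p m)) := X m t.1.1 t.1.2 t.2.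
have Lx m (t : 'I_n * 'I_m * 'I_(p m)) : L4 P (x m t) by exact: LX.
have ix m : mutually_independent P setT (x m).
  apply: (mutually_independent_inj
    (f := fun t : 'I_n * 'I_m * 'I_(p m) => (t.1.1 : nat, t.1.2 : nat, t.2 : nat))
    _ _ (hXind m)).
    by move=> [[? ?] ?] [[? ?] ?] [/val_inj-> /val_inj-> /val_inj->].
  by move=> [[? ?] ?] /=; do ?split.
have x0 m (t : 'I_n * 'I_m * 'I_(p m)) : mean P (x m t) = 0.
  by rewrite /mean /Rintegral hXmean.
have x2 m (t : 'I_n * 'I_m * 'I_(p m)) : mean P (fun w => x m t w ^+ 2) = 1.
  by rewrite /mean /Rintegral hXvar.
have x4 m (t : 'I_n * 'I_m * 'I_(p m)) : mean P (fun w => x m t w ^+ 4) <= kappa.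
  apply: (le_trans (le_mean _ (i1 _ _ _ _) (pow4_le _ _ _ _))).
    by case: (Lx m t).
  by rewrite meanD ?mean_cst ?XC0//; exact: integ_cst.
pose z m := centered_sqr (x m).
have mz m t : measurable_fun setT (z m t).
  by apply: measurable_funB => //; apply: measurable_funX; case: (Lx m t).
have iz m : mutually_independent P setT (z m).
  apply: (mutually_independent_comp (phi := fun _ r => r ^+ 2 - 1)) => // t.
  by apply: measurable_funB => //; exact: measurable_funX.
have z0 m t : mean P (z m t) = 0.
  rewrite meanB ?x2 ?mean_cst ?subrr//; [exact: L4_sqr|exact: integ_cst].
have zle m t w : `|z m t w| `^ (2 + delta) <= 1 + `|x m t w| `^ (4 + eps).
  exact: centered_sqr_powR_le.
have zi m t : integ P (fun w => `|z m t w| `^ (2 + delta)).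
  apply: (integ_dom _ (i1 m t.1.1 t.1.2 t.2)).
    exact: (measurableT_comp (mpow (2 + delta))).
  by move=> w; rewrite ger0_norm ?powR_ge0//; exact: zle.
have zC m t : mean P (fun w => `|z m t w| `^ (2 + delta)) <= kappa.
  apply: (le_trans (le_mean (zi m t) (i1 _ _ _ _) (zle _ _))).
  by rewrite meanD ?mean_cst ?XC0//; exact: integ_cst.
have kappa0 : 0 <= kappa by exact: le_trans kappa1.
have [M hM] := eventually_powR_le hc r0 hmp.
pose c' := (2 * c) `^ (1 + delta).
have bound1 K m : 0 <= K -> (M <= m)%N ->
    K / (p m)%:R `^ (1 + delta) <= K * c' / m%:R `^ (1 + delta).
  by move=> K0 /hM[_ _ h]; rewrite -mulrA; apply: ler_wpM2l.
have bound2 K m : 0 <= K -> (M <= m)%N ->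
    K / (p m)%:R ^+ 2 <= K * c' / m%:R `^ (1 + delta).
  move=> K0 Mm; apply: le_trans (bound1 _ _ K0 Mm).
  have [_ p0 _] := hM _ Mm; apply: ler_wpM2l => //.
  rewrite lef_pV2 ?posrE ?exprn_gt0 ?powR_gt0 ?ltr0n//.
  by rewrite -powR_mulrn//; apply: ler_powR; [rewrite ler1n|lra].
pose noise m w := S m *m sample_mean (fun t => x m t w).
have AbarE m w : Abar n A S X m w = A m + noise m w.
  rewrite /Abar big_split /= sumr_const card_ord -mulmx_sumr scalerDr.
  rewrite -[A m *+ n]scaler_nat scalerA mulVf ?scale1r ?pnatr_eq0 -?lt0n//.
  congr (_ + _); rewrite scalemxAr; congr (_ *m _).
  apply/matrixP => i j; rewrite !mxE summxE; congr (_ * _).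
  by apply: eq_bigr => k _; rewrite mxE.
(* Serves for the all-ones matrix, for [A], and again for the cross term of the quadratic limit. *)
have linear (N : forall m, 'M[R]_(m, p m)) b' : (forall m, ntr (N m) (N m) <= b') ->
    {ae P, forall w, ntr (noise m w) (N m) @[m --> \oo] --> (0 : R)}.
  move=> Nb; apply: (@ae_cvg0_pow4 R delta delta0 d T P _
    ((kappa + 3) * (beta * b') ^+ 2 * c') M) => m Mm.
  have [m0 p0 _] := hM _ Mm.
  have [L h] := mean_ntr_noise_pow4 n0 m0 p0 (@Lx m) (@ix m) (@x0 m) (@x2 m)
    (@x4 m) kappa1 (ST m) (Sbeta m m0) (Nb m).
  split => //; apply: (le_trans h); apply: bound2 => //.
  by rewrite mulr_ge0 ?sqr_ge0// addr_ge0.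
have U1 m : ntr (const_mx 1 : 'M[R]_(m, p m)) (const_mx 1) <= 1.
  rewrite ntrE; under eq_bigr do under eq_bigr do rewrite !mxE mulr1.
  under eq_bigr do rewrite sumr_const card_ord.
  rewrite sumr_const card_ord -mulrnA -natrM [(p m * m)%N]mulnC.
  (* An empty matrix has normalised trace 0, hence an inequality in place of the value 1. *)
  have [->|h] := eqVneq (m * p m)%N 0%N; first by rewrite mulr0.
  by rewrite mulVf// pnatr_eq0.
have offdiag : {ae P, forall w,
    offdiag_part (x m) (S m) w @[m --> \oo] --> (0 : R)}.
  apply: (@ae_cvg0_pow4 R delta delta0 d T P _
    (offdiag_const kappa * beta ^+ 4 * c') M) => m Mm.
  have [m0 p0 _] := hM _ Mm.
  have [L h] := mean_offdiag_part_pow4 n0 m0 p0 (@Lx m) (@ix m) (@x0 m) (@x2 m)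
    (@x4 m) kappa1 (ST m) (Sbeta m m0).
  split => //; apply: (le_trans h); apply: bound2 => //.
  rewrite /offdiag_const !mulr_ge0 ?sqr_ge0 ?exprn_ge0//; lra.
pose v m := diag_weight (n := n) (q := p m) (S m).
have v0 m t : (0 < m)%N -> 0 <= v m t by move=> ?; exact: diag_weight_ge0.
pose J m := index_enum ('I_n * 'I_m * 'I_(p m))%type.
pose small m := small_part (p m)%:R P (z m) (v m) (J m).
pose large m := large_part (p m)%:R P (z m) (v m) (J m).
(* The weights are at most [beta] and sum to at most [beta p], so [B] and [K] of the truncation
   bounds are both [beta]. *)
have smallP : {ae P, forall w, small m w @[m --> \oo] --> (0 : R)}.
  apply: (@ae_cvg0_pow4 R delta delta0 d T P _
    ((16 * beta * beta `^ (1 + delta) * kappa +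
      3 * ((1 + kappa) * (beta * beta)) ^+ 2) * c') M) => m Mm.
  have [m0 p0 _] := hM _ Mm.
  have p1 : 1 <= (p m)%:R :> R by rewrite ler1n.
  split; first exact: L4_small_part.
  have h := mean_small_part p1 delta0 delta1 (@mz m) (@iz m) (@zi m) (@zC m)
    (fun t => v0 m t m0) (diag_weight_le n0 m0 (ST m) (Sbeta m m0))
    beta0 kappa0 beta0 (index_enum_uniq _)
    (sum_diag_weight_le (p m) n0 m0 (ST m) (Sbeta m m0)).
  apply: (le_trans h).
  apply: bound1 => //; by rewrite addr_ge0// !mulr_ge0 ?powR_ge0 ?addr_ge0.
have largeP : {ae P, forall w, `|large m w| @[m --> \oo] --> (0 : R)}.
  apply: (@ae_cvg0 R delta delta0 d T P _
    ((2 * beta * beta `^ (1 + delta) * kappa) * c') M) => // m Mm.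
  have [m0 p0 _] := hM _ Mm.
  have p1 : 1 <= (p m)%:R :> R by rewrite ler1n.
  split; first by apply: integ_norm; exact: (integ_large_part p1 delta0).
  apply: (le_trans (mean_large_part p1 delta0 (@mz m) (@zi m)
    (@zC m) (fun t => v0 m t m0) (diag_weight_le n0 m0 (ST m) (Sbeta m m0))
    kappa0 beta0
    (sum_diag_weight_le (p m) n0 m0 (ST m) (Sbeta m m0)))).
  by apply: bound1 => //; rewrite !mulr_ge0 ?powR_ge0.
have dev m w N : ntr (Abar n A S X m w) N - ntr (A m) N = ntr (noise m w) N.
  by rewrite AbarE ntrDl addrAC subrr add0r.
split; [|split].
- apply: filterS (linear _ _ U1) => w /cvg_norm; rewrite normr0.
  by apply: cvg_trans; apply: near_eq_cvg; apply: nearW => m; rewrite dev.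
- apply: filterS (linear _ _ hb) => w /cvg_norm; rewrite normr0.
  by apply: cvg_trans; apply: near_eq_cvg; apply: nearW => m; rewrite dev.
apply: filterS2 (filterI smallP largeP) (filterI offdiag (linear _ _ hb)).
move=> w [sw /norm_cvg0 lw] [ow lin].
(* The expansion of [ntr (A + N) (A + N)] for the noise [N]: the cross term twice, then the centred
   noise square in its three parts. *)
have lim0 : (ntr (noise m w) (A m) + ntr (noise m w) (A m) + (offdiag_part (x m) (S m) w +
    (small m w + large m w))) @[m --> \oo] --> (0 : R).
  have := cvgD (cvgD lin lin) (cvgD ow (cvgD sw lw)).
  by rewrite !addr0; exact.
move/cvg_norm: lim0; rewrite normr0; apply: cvg_trans.
(* The noise decomposition divides by [m] and [p m], which are known to be positive from [M] on. *)
apply: near_eq_cvg; exists M => // m /= Mm.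
have [m0 p0 _] := hM _ Mm.
have p1 : 1 <= (p m)%:R :> R by rewrite ler1n.
congr (`| _ |).
rewrite -(small_partD p1 delta0 (v m) (@mz m) (@z0 m) (@zi m)).
rewrite -ntr_noise_decomp// AbarE ntrDl [ntr (A m) (_ + _)]ntrC.
rewrite [ntr (noise m w) (_ + _)]ntrC !ntrDl [ntr (A m) (noise m w)]ntrC SS.
by rewrite -/(noise m w); ring.
Qed.
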